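(* Let $G$ be a connected claw-free graph of even order, given by neighborhood lists. The algorithm PMinCF described below, applied to $G$, outputs a perfect matching of $G$, and it can be implemented to run in $O(m(G))$ time, where $m(G)$ is the number of edges of $G$. Algorithm PMinCF: Set $M\leftarrow\emptyset$, $k\leftarrow 0$, and $\mathrm{lm\_nb}(u)\leftarrow -1$ for every vertex $u$. While the current graph $G$ has at least $2$ vertices, do the following. If $k=0$, set $k\leftarrow 2$, $u_1\leftarrow u$, $u_2\leftarrow v$ for some edge $uv$ of the current $G$. Then repeat the following step until in one execution of it no extension is made: (i) if there is $v\in N_G(u_k)\setminus\{u_1,\ldots,u_k\}$, set $u_{k+1}\leftarrow v$, $k\leftarrow k+1$ (an extension is made); (ii) otherwise, if $\mathrm{lm\_nb}(u_k)=-1$, set $\mathrm{lm\_nb}(u_k)\leftarrow\max\{\ell\in\{1,\ldots,k-1\}: u_{k-i}\in N_G(u_k)\text{ for all } i\in\{1,\ldots,\ell\}\}$; then, if $\mathrm{lm\_nb}(u_k)\geq 2$ and there is $v\in N_G(u_{k-1})\setminus\{u_1,\ldots,u_k\}$, set $\mathrm{lm\_nb}(u_k)\leftarrow\mathrm{lm\_nb}(u_k)-1$, and if $\mathrm{lm\_nb}(u_{k-1})\neq -1$ set $\mathrm{lm\_nb}(u_{k-1})\leftarrow \mathrm{lm\_nb}(u_{k-1})+1$; then exchange $u_{k-1}$ and $u_k$ (the new $u_{k-1}$ is the old $u_k$ and the new $u_k$ is the old $u_{k-1}$), set $u_{k+1}\leftarrow v$ and $k\leftarrow k+1$ (an extension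 is made). After the repeat loop ends, set $M\leftarrow M\cup\{u_{k-1}u_k\}$, $G\leftarrow G-\{u_{k-1},u_k\}$, and $k\leftarrow k-2$. When the while loop ends, return $M$.
   Context: A graph is claw-free if it has no induced $K_{1,3}$. Throughout the algorithm, $G$ denotes the current graph (vertices are deleted as the algorithm proceeds) and $N_G(u)$ denotes the neighborhood of $u$ in the current graph; $u_1\ldots u_k$ is the current path maintained by the algorithm. *)

(* Defs.v *)
From mathcomp Require Import all_boot all_order all_algebra.

Set Implicit Arguments.
Unset Strict Implicit.
Unset Printing Implicit Defensive.

Import GRing.Theory Num.Theory.

(* A finite simple graph is a symmetric irreflexive relation                  *)
(* [e] on a finType [V].                                                      *)

Section Graphs.

Variables (V : finType) (e : rel V).

Definition edges : {set {set V}} :=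
  [set [set x; y] | x in [set: V], y in [set: V] & e x y].

(* The graph with no vertex does not count as connected. *)
Definition connected_graph : Prop :=
  0 < #|V| /\ forall x y : V, connect e x y.

(* K_{1,3} on {0,1,2,3}, with centre 0. *)
Definition K13 : rel 'I_4 := fun i j => (i == ord0) != (j == ord0).

Definition claw_free : Prop :=
  ~ exists f : 'I_4 -> V,
      injective f /\ forall i j, e (f i) (f j) = K13 i j.

Definition perfect_matching (M : {set {set V}}) : Prop :=
  [/\ M \subset edges, trivIset M & cover M = [set: V]].

End Graphs.

Section PMinCF.

Variables (V : finType) (e : rel V).

(* [AtWhile]: about to evaluate the condition of the while loop;              *)
(* [AtRepeat]: about to execute the step of the repeat loop;                  *)
(* [AfterRepeat]: the repeat loop has just ended.                             *)
Inductive control := AtWhile | AtRepeat | AfterRepeat.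

(* [upath] is the sequence u_1 ... u_k; in particular k = size upath. *)
Record state := State {
  ctrl : control;
  matching : {set {set V}};
  current : {set V};
  upath : seq V;
  lm_nb : {ffun V -> int}
}.

Definition initial : state :=
  State AtWhile set0 [set: V] [::] [ffun=> (-1)%R].

Definition nbhd (G : {set V}) (u : V) : {set V} := [set v in G | e u v].

(* The possible extensions at [u]. *)
Definition fresh (G : {set V}) (p : seq V) (u : V) : {set V} :=
  nbhd G u :\: [set w in p].

(* With u_1 ... u_k = rcons p x, so that k - 1 = size p and u_j is the item   *)
(* of rank j.-1: membership in the set whose maximum defines lm_nb(u_k).      *)
Definition lm_range (G : {set V}) (p : seq V) (x : V) (l : nat) : Prop :=
  1 <= l <= size p /\
  forall i, 1 <= i <= l ->
    nth x (rcons p x) ((size p).+1 - i).-1 \in nbhd G x.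

Definition upd (L : {ffun V -> int}) (x : V) (a : int) : {ffun V -> int} :=
  [ffun w => if w == x then a else L w].

Definition lm_compute (G : {set V}) (p : seq V) (x : V)
    (L L' : {ffun V -> int}) : Prop :=
  if L x == (-1)%R then
    exists l : nat,
      [/\ lm_range G p x l, (forall l', lm_range G p x l' -> l' <= l)
        & L' = upd L x (Posz l)]
  else L' = L.

(* Bookkeeping when u_{k-1} = y and u_k = x are exchanged. *)
Definition lm_exchange (y x : V) (L : {ffun V -> int}) : {ffun V -> int} :=
  let L1 := upd L x (L x - 1)%R in
  if L1 y != (-1)%R then upd L1 y (L1 y + 1)%R else L1.

(* One step of PMinCF. All choices are left open. A situation in which the    *)
(* algorithm is not defined (no edge to start from, maximum of an empty set,  *)
(* no vertex u_{k-1}) is a state without successor.                           *)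
Inductive step : state -> state -> Prop :=
| Start (M : {set {set V}}) (G : {set V})
    (u v : V) (L : {ffun V -> int}) :
    2 <= #|G| -> u \in G -> v \in nbhd G u ->
    step (State AtWhile M G [::] L) (State AtRepeat M G [:: u; v] L)
| Resume (M : {set {set V}}) (G : {set V})
    (p : seq V) (L : {ffun V -> int}) :
    2 <= #|G| -> p != [::] ->
    step (State AtWhile M G p L) (State AtRepeat M G p L)
| Extend (M : {set {set V}}) (G : {set V})
    (p : seq V) (x v : V) (L : {ffun V -> int}) :
    v \in fresh G (rcons p x) x ->
    step (State AtRepeat M G (rcons p x) L)
         (State AtRepeat M G (rcons (rcons p x) v) L)
| ExchangeExtend (M : {set {set V}}) (G : {set V})
    (p : seq V) (y x v : V) (L L' : {ffun V -> int}) :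
    fresh G (rcons (rcons p y) x) x = set0 ->
    lm_compute G (rcons p y) x L L' ->
    (2 <= L' x)%R ->
    v \in fresh G (rcons (rcons p y) x) y ->
    step (State AtRepeat M G (rcons (rcons p y) x) L)
         (State AtRepeat M G (rcons (rcons (rcons p x) y) v)
                (lm_exchange y x L'))
| NoExtension (M : {set {set V}}) (G : {set V})
    (p : seq V) (y x : V) (L L' : {ffun V -> int}) :
    fresh G (rcons (rcons p y) x) x = set0 ->
    lm_compute G (rcons p y) x L L' ->
    ~~ ((2 <= L' x)%R && (fresh G (rcons (rcons p y) x) y != set0)) ->
    step (State AtRepeat M G (rcons (rcons p y) x) L)
         (State AfterRepeat M G (rcons (rcons p y) x) L')
| Match (M : {set {set V}}) (G : {set V})
    (p : seq V) (y x : V) (L : {ffun V -> int}) :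
    step (State AfterRepeat M G (rcons (rcons p y) x) L)
         (State AtWhile (M :|: [set [set y; x]]) (G :\: [set y; x]) p L).

Definition returned (s : state) : Prop :=
  ctrl s = AtWhile /\ #|current s| < 2.

(* Every execution from [s] terminates, never gets stuck, and returns a set   *)
(* satisfying [Q], whatever choices are made.                                 *)
Inductive always_returns (Q : {set {set V}} -> Prop) (s : state) : Prop :=
| Always_returned : returned s -> Q (matching s) -> always_returns Q s
| Always_step :
    (exists s', step s s') ->
    (forall s', step s s' -> always_returns Q s') -> always_returns Q s.

End PMinCF.

(* The machine: imperative programs over finitely many registers and arrays   *)
(* of natural numbers, all cells being initially 0 apart from the input. Each *)
(* assignment and each test costs one unit; a program is a fixed text, so     *)
(* this is within a constant factor of charging every elementary operation.   *)
(* The only arithmetic is +1 and -1: after T units of time the values are     *)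
(* at most (largest input value) + O(T), so memory words stay of logarithmic  *)
(* length.                                                                    *)

Inductive expr :=
| Const of nat
| Reg of nat
| Read of nat & expr
| Succ of expr
| Pred of expr.

Inductive test :=
| Lt of expr & expr
| Eq of expr & expr
| Not of test
| And of test & test.

Inductive cmd :=
| Assign of nat & expr
| Write of nat & expr & expr
| If of test & seq cmd & seq cmd
| While of test & seq cmd.

Definition program := seq cmd.

Record store := Store { reg : nat -> nat; arr : nat -> nat -> nat }.

Fixpoint eval (m : store) (a : expr) : nat :=
  match a with
  | Const c => c
  | Reg r => reg m r
  | Read A i => arr m A (eval m i)
  | Succ b => (eval m b).+1
  | Pred b => (eval m b).-1
  end.

Fixpoint holds (m : store) (b : test) : bool :=
  match b with
  | Lt a1 a2 => eval m a1 < eval m a2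
  | Eq a1 a2 => eval m a1 == eval m a2
  | Not b1 => ~~ holds m b1
  | And b1 b2 => holds m b1 && holds m b2
  end.

Definition set_reg (m : store) (r c : nat) : store :=
  Store (fun r' => if r' == r then c else reg m r') (arr m).

Definition set_arr (m : store) (A i c : nat) : store :=
  Store (reg m)
    (fun A' i' => if (A' == A) && (i' == i) then c else arr m A' i').

(* The commands that remain to be executed, and the memory. *)
Definition config := (seq cmd * store)%type.

Definition tick (c : config) : config :=
  let: (todo, m) := c in
  match todo with
  | [::] => c
  | Assign r a :: k => (k, set_reg m r (eval m a))
  | Write A i a :: k => (k, set_arr m A (eval m i) (eval m a))
  | If b c1 c2 :: k => ((if holds m b then c1 else c2) ++ k, m)
  | While b c1 :: k => (if holds m b then c1 ++ todo else k, m)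
  end.

Definition halted (c : config) : Prop := c.1 = [::].

(* Registers and arrays with a prescribed meaning; all others are free        *)
(* working storage.                                                           *)
Definition rN := 0.      (* number of vertices *)
Definition rK := 1.      (* k *)
Definition rM := 2.      (* number of edges of M *)
Definition aStart := 0.  (* where each neighborhood list starts in aNb *)
Definition aNb := 1.     (* the neighborhood lists, one after the other *)
Definition aU := 2.      (* u_1, ..., u_k at indices 1, ..., k *)
Definition aLm := 3.     (* lm_nb + 1, since memory cells are never negative *)
Definition aDel := 4.    (* nonzero for the deleted vertices *)
Definition aM1 := 5.     (* the two ends of the edges of M, at indices *)
Definition aM2 := 6.     (* 0, ..., rM - 1 *)

Section Implementation.

Variables (n : nat) (e : rel 'I_n) (nb : 'I_n -> seq 'I_n).

Definition neighborhood_lists : Prop :=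
  forall u : 'I_n, uniq (nb u) /\ forall v, (v \in nb u) = e u v.

(* The list of u occupies the cells aStart[u], ..., aStart[u+1] - 1 of aNb. *)
Definition input : store :=
  Store
    (fun r => if r == rN then n else 0)
    (fun A i =>
       if A == aStart then sumn (take i [seq size (nb u) | u <- enum 'I_n])
       else if A == aNb then
         nth 0 (flatten [seq [seq val v | v <- nb u] | u <- enum 'I_n]) i
       else 0).

Definition represents (m : store) (s : state 'I_n) : Prop :=
  [/\ exists es : seq ('I_n * 'I_n),
        [/\ [seq (val f.1, val f.2) | f <- es] =
              mkseq (fun i => (arr m aM1 i, arr m aM2 i)) (reg m rM),
            matching s = [set [set f.1; f.2] | f in es]
          & #|matching s| = reg m rM],
      forall v : 'I_n, (arr m aDel v == 0) = (v \in current s),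
      [seq val u | u <- upath s] =
        mkseq (fun i => arr m aU i.+1) (reg m rK)
    & forall v : 'I_n, Posz (arr m aLm v) = (lm_nb s v + 1)%R].

(* On the given neighborhood lists, [P] carries out a complete execution      *)
(* s_0, ..., s_l of PMinCF: its memory represents these states one after the  *)
(* other, and at the last one, within T units of time, it halts.              *)
Definition implements_within (P : program) (T : nat) : Prop :=
  exists (l : nat) (s : nat -> state 'I_n) (t : nat -> nat),
    let conf i := iter (t i) tick (P, input) in
    [/\ s 0 = initial 'I_n /\ (forall i, i < l -> step e (s i) (s i.+1)),
        returned (s l),
        (forall i, i < l -> t i <= t i.+1),
        (forall i, i <= l -> represents (conf i).2 (s i))
      & halted (conf l) /\ t l <= T].

End Implementation.

(* Main.v *)
Require Import Defs.
From mathcomp Require Import all_boot all_order all_algebra.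
From mathcomp Require Import zify.

Set Implicit Arguments.
Unset Strict Implicit.
Unset Printing Implicit Defensive.

(* Correctness: the current graph stays connected. When the repeat loop ends,
   u_k has no neighbor off the path; either u_(k-1) has none too, or u_k is not
   adjacent to u_(k-2), and then claw-freeness at u_(k-1) makes every
   neighbor of u_(k-1) off the path adjacent to u_(k-2) (to each other, if
   k = 2). In both cases deleting u_(k-1) and u_k preserves connectedness. The
   cached lm_nb stay exact because a vertex on the path only ever changes its
   predecessors through an exchange.

   Running time: a vertex that has been on the path stays there until it is
   deleted, so each neighborhood list is scanned for extensions by a pointer
   that never moves back, and lm_nb(u) is computed once per vertex, in time
   O(deg u), after marking the neighbors of u. *)

(** * Deleting the last two vertices of the path *)

(** Both halves rest on one invariant, [run_inv], and one decreasing [measure], linear in the number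
    of vertices. All choices being open, correctness amounts to this: every rule preserves the
    invariant, and the invariant always permits some rule. The program then has to realize just one
    permitted execution, and the invariant guarantees that its lookups succeed: a starting edge, a
    vertex u_(k-1) to exchange with. A single step has no constant time bound, since it may scan
    lists. Its loops are therefore paid from a potential [pot], made of the list entries not yet
    passed, the degrees of the vertices whose lm_nb is unknown, and the indices not yet passed in
    the search for a start vertex. A step costs O(1) beyond the drop of [pot], which gives O(n + m);
    this is O(m) because a connected graph of positive even order has no isolated vertex. *)

Section Correctness.

Variables (V : finType) (e : rel V).
Hypotheses (esym : symmetric e) (eirr : irreflexive e) (claw : claw_free e).

Lemma edge_neq x y : e x y -> x != y.
Proof. by apply: contraTneq => ->; rewrite eirr. Qed.

Lemma claw_freeP c x y z : e c x -> e c y -> e c z ->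
  x != y -> x != z -> y != z -> [|| e x y, e x z | e y z].
Proof.
move=> cx cy cz xy xz yz; apply/negP => /negP; rewrite !negb_or.
case/and3P => /negbTE nxy /negbTE nxz /negbTE nyz; apply: claw.
pose s := [:: c; x; y; z].
have us : uniq s.
  by rewrite /= !inE !negb_or (edge_neq cx) (edge_neq cy) (edge_neq cz) xy xz yz.
exists (fun i : 'I_4 => nth c s i); split.
  by move=> i j /eqP; rewrite nth_uniq // => /eqP/val_inj.
have := (cx, cy, cz); rewrite esym (esym c y) (esym c z) => -[[xc yc] zc].
have := (nxy, nxz, nyz); rewrite esym (esym x z) (esym y z) => -[[nyx nzx] nzy].
move=> [[|[|[|[|i]]]] ilt] [[|[|[|[|j]]]] jlt] //=; rewrite ?eirr /K13 -?val_eqE //=.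
Qed.

(* The true value of lm_nb(x) when [x] follows [p] on the path. *)
Definition lm_val (p : seq V) (x : V) : nat := find (predC (e x)) (rev p).

Lemma lm_val_rcons p y x :
  lm_val (rcons p y) x = if e x y then (lm_val p x).+1 else 0.
Proof. by rewrite /lm_val rev_rcons /=; case: (e x y). Qed.

Lemma lm_val_size p x : lm_val p x <= size p.
Proof. by rewrite /lm_val -(size_rev p) find_size. Qed.

(** All conditions concern one run of neighbors of [x], read backwards from the end of [p], so the
    admissible lengths form an initial segment. The maximum taken by PMinCF thus exists exactly when
    this run is nonempty, and it equals [lm_val]. *)
Lemma lm_rangeE (G : {set V}) (p : seq V) x l : {subset p <= G} ->
  lm_range e G p x l <-> 1 <= l <= lm_val p x.
Proof.
move=> pG; split=> [[/andP[l0 lp] H]|/andP[l0 lv]].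
  rewrite l0 leqNgt; apply/negP => vl.
  have vlt : lm_val p x < size (rev p) by rewrite size_rev; apply: leq_trans lp.
  (* A length beyond [lm_val] would include the vertex at which the run breaks. *)
  have := nth_find x (etrans (has_find _ _) vlt); rewrite /= -/(lm_val p x).
  rewrite nth_rev -?(size_rev p) // size_rev => /negP; apply.
  have := H (lm_val p x).+1 ltac:(by []).
  rewrite size_rev in vlt; rewrite inE nth_rcons => /andP[_].
  have -> : ((size p).+1 - (lm_val p x).+1).-1 = size p - (lm_val p x).+1 by lia.
  by rewrite ifT // ltn_subrL; apply: leq_ltn_trans vlt.
have lp := leq_trans lv (lm_val_size p x).
split; first by rewrite l0.
move=> i /andP[i0 il]; rewrite nth_rcons ifT; last by lia.
have ilt : i.-1 < size p by lia.
have iv : i.-1 < lm_val p x by lia.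
have /negbFE := before_find x iv; rewrite nth_rev //=.
have -> : ((size p).+1 - i).-1 = size p - i.-1.+1 by lia.
by rewrite inE pG // mem_nth // ltn_subrL; apply: leq_ltn_trans ilt.
Qed.

(* Stated with cuts because the deletion argument compares the cuts of the
   smaller graph with those of [G]. *)
Definition cut_connected (G : {set V}) : Prop :=
  forall A : {set V}, A != set0 -> A \proper G ->
    exists x y, [/\ x \in A, y \in G :\: A & e x y].

Lemma connected_cut : connected_graph e -> cut_connected [set: V].
Proof.
move=> [_ conn] A A0 Aprop.
case: (boolP [exists x in A, exists y in ~: A, e x y]) => [/exists_inP[x xA]|].
  by case/exists_inP => y; rewrite in_setC => yA xy; exists x, y; split; rewrite ?inE ?yA.
move=> no; exfalso.
have cl : closed e (mem A).
  move=> x y xy; apply/idP/idP => [xA|yA]; apply: contraR no => nA.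
    by apply/exists_inP; exists x => //; apply/exists_inP; exists y; rewrite // inE.
  apply/exists_inP; exists y => //; apply/exists_inP; exists x; rewrite ?inE //.
  by rewrite esym.
case/set0Pn: A0 => x xA; case/properP: Aprop => _ [y _ /negP[]].
by have := closed_connect cl (conn x y) => /= <-.
Qed.

Lemma in_fresh (G : {set V}) p u v : (v \in fresh e G p u) = [&& v \notin p, v \in G & e u v].
Proof. by rewrite !inE. Qed.

Lemma fresh0 (G : {set V}) p u : fresh e G p u = set0 ->
  forall v, v \in G -> v \notin p -> e u v = false.
Proof.
move=> F v vG vp; apply: contraTF isT => uv.
by have := in_fresh G p u v; rewrite F inE vp vG uv.
Qed.

Lemma sorted_rconsE (p : seq V) y x :
  sorted e (rcons (rcons p y) x) = sorted e (rcons p y) && e y x.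
Proof. by case: p => [|a p] /=; rewrite ?andbT // rcons_path last_rcons. Qed.

(** This places the whole remaining path on one side of a cut without crossing edges, namely the
    side of its first vertex. *)
Lemma path_side (A B : {set V}) : (forall a b, a \in A -> b \in B -> e a b = false) ->
  forall p x, {subset p <= A :|: B} -> x \in B -> path e x p -> {subset p <= B}.
Proof.
move=> sep; elim=> //= y p IH x pG xB /andP[xy yp].
have yB : y \in B.
  have := pG y (mem_head _ _); rewrite inE => /orP[yA|//].
  by have := sep _ _ yA xB; rewrite esym xy.
move=> z; rewrite inE => /orP[/eqP->//|zp].
by apply: (IH y) => // w wp; apply: pG; rewrite inE wp orbT.
Qed.

(** Suppose no edge joins [A] to the rest [B] of the smaller graph. In [G], a side that avoids [p]
    is left by some edge, whose far end can only be [y]. If [p] is empty, both sides are of this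
    kind, and their neighbors of [y] form with [x] a claw at [y]. Otherwise [p] lies within one
    side; its last vertex [z], a neighbor of [y] in the other side, and [x] form the claw. *)
Lemma delete_pair_connected (G : {set V}) (p : seq V) y x :
  cut_connected G -> {subset rcons (rcons p y) x <= G} ->
  uniq (rcons (rcons p y) x) -> sorted e (rcons (rcons p y) x) ->
  fresh e G (rcons (rcons p y) x) x = set0 ->
  fresh e G (rcons (rcons p y) x) y = set0 \/ lm_val (rcons p y) x <= 1 ->
  cut_connected (G :\: [set y; x]).
Proof.
move=> conn sub un so fx fy A A0 Aprop.
case: (boolP [exists a in A, exists b in (G :\: [set y; x]) :\: A, e a b]).
  by case/exists_inP => a aA /exists_inP[b bB ab]; exists a, b.
move=> no; exfalso.
set B := (G :\: [set y; x]) :\: A in no *.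
have AG a : a \in A -> a \in G :\: [set y; x] by apply/subsetP/proper_sub.
have sep a b : a \in A -> b \in B -> e a b = false.
  move=> aA bB; apply: contraNF no => ab.
  by apply/exists_inP; exists a => //; apply/exists_inP; exists b.
have sep' b a : b \in B -> a \in A -> e b a = false.
  by move=> bB aA; rewrite esym sep.
have B0 : B != set0.
  by case/properP: Aprop => _ [b bG bA]; apply/set0Pn; exists b; rewrite inE bA.
have BG b : b \in B -> b \in G :\: [set y; x] by rewrite inE => /andP[].
have xG : x \in G by apply: sub; rewrite mem_rcons mem_head.
have [yx pG] : e y x /\ {subset p <= G :\: [set y; x]}.
  move: so; rewrite sorted_rconsE => /andP[_ yx]; split=> // z zp.
  have zG : z \in G by apply: sub; rewrite !(mem_rcons, inE) zp !orbT.
  move: un; rewrite !rcons_uniq mem_rcons inE negb_or => /and3P[/andP[_ xp] yp _].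
  by rewrite !inE zG andbT negb_or; apply/andP; split; apply: contraTneq zp => ->.
(* Each side is joined to [y] or [x]; outside the path, it has to be [y]. *)
have link (C D : {set V}) : C != set0 -> C \proper G ->
    (forall z, z \in G :\: [set y; x] -> (z \in C) || (z \in D)) ->
    (forall a b, a \in C -> b \in D -> e a b = false) ->
    {subset C <= G :\: [set y; x]} -> {in C, forall z, z \notin p} ->
    exists2 a, a \in C & [/\ e y a, e x a = false &
       fresh e G (rcons (rcons p y) x) y != set0].
  move=> C0 Cp CD sepCD CG Cnp; have [a [b [aC]]] := conn C C0 Cp.
  rewrite inE => /andP[bC bG] ab; exists a => //.
  have := CG _ aC; rewrite !inE negb_or => /andP[/andP[ay ax] aG].
  have ap : a \notin rcons (rcons p y) x.
    by rewrite !(mem_rcons, inE) !negb_or ax ay Cnp.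
  have xa := fresh0 fx aG ap.
  have ya : e y a.
    have [byx|nbyx] := boolP (b \in [set y; x]).
      by move: byx ab; rewrite !inE => /orP[]/eqP-> ; rewrite esym // xa.
    have bD : b \in D by have := CD b; rewrite inE nbyx bG (negbTE bC); apply.
    by rewrite sepCD in ab.
  by split=> //; apply/set0Pn; exists a; rewrite in_fresh ap aG.
have AB z : z \in G :\: [set y; x] -> (z \in A) || (z \in B).
  by move=> zG; rewrite /B in_setD zG andbT orbN.
have BA z : z \in G :\: [set y; x] -> (z \in B) || (z \in A).
  by move=> zG; rewrite orbC AB.
have prop (C : {set V}) : {subset C <= G :\: [set y; x]} -> C \proper G.
  move=> CG; apply/properP; split.
    by apply/subsetP => z /CG; rewrite inE => /andP[].
  by exists x => //; apply/negP => /CG; rewrite !inE eqxx orbT.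
(* [link] produces an extension at [y], which excludes the first alternative of the hypothesis. *)
have {fy} lm1 : fresh e G (rcons (rcons p y) x) y != set0 -> lm_val (rcons p y) x <= 1.
  by case: fy => [->|//]; rewrite eqxx.
have nx (C : {set V}) (CG : {subset C <= G :\: [set y; x]}) a : a \in C -> x != a.
  by move=> /CG; apply: contraTneq => <-; rewrite !inE eqxx orbT.
case: (lastP p) => [|p' z] in so pG link lm1 *.
  have [a aA [ya xa _]] := link A B A0 (prop _ AG) AB sep AG (fun _ _ => isT).
  have [b bB [yb xb _]] := link B A B0 (prop _ BG) BA sep' BG (fun _ _ => isT).
  have ab : a != b.
    by apply: contraTneq bB => <-; rewrite inE aA.
  have := claw_freeP yx ya yb (nx _ AG _ aA) (nx _ BG _ bB) ab.
  by rewrite xa xb sep.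
have side (C D : {set V}) : C != set0 ->
    (forall z, z \in G :\: [set y; x] -> (z \in C) || (z \in D)) ->
    (forall a b, a \in C -> b \in D -> e a b = false) ->
    {subset C <= G :\: [set y; x]} -> {subset D <= G :\: [set y; x]} ->
    (forall w, w \in C -> w \notin D) ->
    head y (rcons p' z) \in D -> False.
  move=> C0 CD sepCD CG DG disj hD.
  have pD : {subset rcons p' z <= D}.
    have : sorted e (rcons p' z).
      by move: so; rewrite !sorted_rconsE => /andP[/andP[]].
    case: (rcons p' z) hD pG => //= h t hD pG hp w; rewrite inE => /orP[/eqP->//|].
    apply: (path_side sepCD _ hD hp) => v vt; rewrite inE.
    by apply: CD; apply: pG; rewrite inE vt orbT.
  have Cnp : {in C, forall w, w \notin rcons p' z}.
    by move=> w wC; apply/negP => /pD; apply/negP; apply: disj.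
  have [a aC [ya xa fr]] := link C D C0 (prop _ CG) CD sepCD CG Cnp.
  have zD : z \in D by apply: pD; rewrite mem_rcons mem_head.
  have yz : e y z by move: so; rewrite !sorted_rconsE esym => /andP[/andP[]].
  (* As [x] is adjacent to [y], a value of at most 1 means that the run breaks at [z]. *)
  have xz : e x z = false.
    move: (lm1 fr); rewrite !lm_val_rcons esym yx.
    by case: (e x z).
  have za : z != a by apply: contraTneq zD => ->; apply: disj.
  have := claw_freeP yx yz ya (nx _ DG _ zD) (nx _ CG _ aC) za.
  by rewrite xz xa esym sepCD.
have hG : head y (rcons p' z) \in G :\: [set y; x].
  by apply: pG; case: (p') => [|h t] /=; rewrite mem_head.
have disjAB w : w \in A -> w \notin B by move=> wA; rewrite inE wA.
have disjBA w : w \in B -> w \notin A by rewrite inE => /andP[].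
case/orP: (AB _ hG); first exact: side BA sep' BG AG disjBA.
exact: side AB sep AG BG disjAB.
Qed.

End Correctness.

(** * Correctness *)

Section Invariant.

Variables (V : finType) (e : rel V).

(** * Exactness of the cached lm_nb along the path *)

Definition lm_ok (p : seq V) (L : {ffun V -> int}) : Prop :=
  forall p1 x p2, p = rcons p1 x ++ p2 ->
    L x = (-1)%R \/ L x = Posz (lm_val e p1 x).

Lemma lm_ok_rcons p x L :
  lm_ok (rcons p x) L <->
  lm_ok p L /\ (L x = (-1)%R \/ L x = Posz (lm_val e p x)).
Proof.
split=> [H|[H Hx] p1 z p2]; first split.
- by move=> p1 z p2 pE; apply: (H p1 z (rcons p2 x)); rewrite pE rcons_cat.
- by apply: (H p x [::]); rewrite cats0.
case: (lastP p2) => [|q w]; first by rewrite cats0 => /rcons_inj[<- <-].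
by rewrite -rcons_cat => /rcons_inj[pE _]; apply: (H p1 z q).
Qed.

Lemma eq_lm_ok p (L L' : {ffun V -> int}) :
  {in p, L =1 L'} -> lm_ok p L -> lm_ok p L'.
Proof.
move=> LL H p1 x p2 pE; rewrite -LL; first exact: H pE.
by rewrite pE mem_cat mem_rcons mem_head.
Qed.

(** [good_unset] lets every vertex enter the path with an empty cache. It persists because a vertex
    leaves the path only by being deleted from [G]. *)
Record good (G : {set V}) (p : seq V) (L : {ffun V -> int}) : Prop := Good {
  good_sub : {subset p <= G};
  good_uniq : uniq p;
  good_sorted : sorted e p;
  good_lm : lm_ok p L;
  good_unset : forall x, x \in G -> x \notin p -> L x = (-1)%R }.

Lemma good_start G L u v : good G [::] L -> u \in G -> v \in nbhd e G u ->
  u != v -> good G [:: u; v] L.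
Proof.
move=> g uG; rewrite inE => /andP[vG uv] nuv; split.
- by move=> x; rewrite !inE => /orP[]/eqP->.
- by rewrite /= inE nuv.
- by rewrite /= uv.
- rewrite -[[:: u; v]]/(rcons (rcons [::] u) v); apply/lm_ok_rcons; split.
    apply/lm_ok_rcons; split; first exact: good_lm g.
    by left; apply: (good_unset g).
  by left; apply: (good_unset g).
- by move=> x xG _; apply: (good_unset g).
Qed.

Lemma good_extend G p x v L : good G (rcons p x) L ->
  v \in fresh e G (rcons p x) x -> good G (rcons (rcons p x) v) L.
Proof.
move=> g; rewrite in_fresh => /and3P[vp vG xv]; split.
- by move=> w; rewrite mem_rcons inE => /orP[/eqP->//|]; apply: good_sub g _.
- by rewrite rcons_uniq vp (good_uniq g).
- by rewrite sorted_rconsE (good_sorted g).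
- apply/lm_ok_rcons; split; first exact: good_lm g.
  by left; apply: good_unset g _ vG vp.
- move=> w wG; rewrite mem_rcons inE negb_or => /andP[_].
  exact: good_unset g _ wG.
Qed.

(** A value already cached is exact by the invariant, a new one by [lm_rangeE]; so the test of
    PMinCF always sees the true [lm_val]. *)
Lemma good_compute G p y x L L' : symmetric e ->
  good G (rcons (rcons p y) x) L ->
  lm_compute e G (rcons p y) x L L' ->
  good G (rcons (rcons p y) x) L' /\ L' x = Posz (lm_val e (rcons p y) x).
Proof.
move=> esym g; rewrite /lm_compute.
case: eqVneq => [Lx [l [lr lmax L'E]]|Lx ->]; last first.
  split=> //; have /lm_ok_rcons[_ []//] := good_lm g.
  by move=> Lx1; rewrite Lx1 eqxx in Lx.
have sub : {subset rcons p y <= G}.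
  by move=> z zp; apply: good_sub g _ _; rewrite mem_rcons inE zp orbT.
have lE : l = lm_val e (rcons p y) x.
  move/(lm_rangeE _ _ _ sub): lr => /andP[l0 lv].
  apply/eqP; rewrite eqn_leq lv; apply: lmax; apply/(lm_rangeE _ _ _ sub).
  by rewrite leqnn andbT (leq_trans l0).
have L'x : L' x = Posz (lm_val e (rcons p y) x) by rewrite L'E ffunE eqxx lE.
have L'z z : z != x -> L' z = L z by rewrite L'E ffunE => /negbTE ->.
split=> //; split; [exact: good_sub g|exact: good_uniq g|exact: good_sorted g| |].
  apply/lm_ok_rcons; split; last by right.
  have := good_lm g => /lm_ok_rcons[+ _]; apply: eq_lm_ok => z zp.
  rewrite L'z //; apply: contraTneq zp => ->.
  by have := good_uniq g; rewrite rcons_uniq => /andP[].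
move=> z zG zp; rewrite L'z; first exact: good_unset g _ zG zp.
by apply: contraNneq zp => ->; rewrite mem_rcons mem_head.
Qed.

Lemma mem_exchange (p : seq V) y x :
  rcons (rcons p x) y =i rcons (rcons p y) x.
Proof. by move=> z; rewrite !(mem_rcons, inE) orbCA. Qed.

Lemma fresh_exchange G (p : seq V) y x u :
  fresh e G (rcons (rcons p x) y) u = fresh e G (rcons (rcons p y) x) u.
Proof. by apply/setP => v; rewrite !in_fresh mem_exchange. Qed.

(* The exchange costs [x] its last neighbor [y] and puts [x] in front of [y],
   which is what the corrections of [lm_nb] account for. *)
Lemma good_exchange G p y x L : symmetric e ->
  good G (rcons (rcons p y) x) L -> (2 <= L x)%R ->
  L x = Posz (lm_val e (rcons p y) x) ->
  good G (rcons (rcons p x) y) (lm_exchange y x L).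
Proof.
move=> esym g L2 Lx.
have yx : e y x by have := good_sorted g; rewrite sorted_rconsE => /andP[].
have xy : e x y by rewrite esym.
have := good_uniq g; rewrite !rcons_uniq mem_rcons inE negb_or.
case/and3P => /andP[nxy xp] yp up.
have nyx : y != x by rewrite eq_sym.
have [Ex Ey Ez] : [/\ lm_exchange y x L x = (L x - 1)%R,
    lm_exchange y x L y = (if L y == (-1)%R then (-1)%R else (L y + 1)%R)
    & forall z, z != x -> z != y -> lm_exchange y x L z = L z].
  split; rewrite /lm_exchange /upd !ffunE (negbTE nyx).
  - by case: ifP; rewrite !ffunE ?eqxx ?(negbTE nxy).
  - by case: eqP => [Ly|] /=; rewrite !ffunE ?eqxx ?(negbTE nyx).
  - by move=> z /negbTE zx /negbTE zy; case: ifP; rewrite !ffunE zx ?zy.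
have /lm_ok_rcons[/lm_ok_rcons[okp oky] _] := good_lm g.
have lx : 1 < lm_val e (rcons p y) x by rewrite Lx in L2.
move: Lx lx; rewrite lm_val_rcons xy => Lx lx.
split.
- by move=> z; rewrite mem_exchange; apply: good_sub g _.
- by rewrite !rcons_uniq mem_rcons inE negb_or nyx yp xp up.
- rewrite sorted_rconsE xy andbT.
  have /andP[] : sorted e (rcons p y) && e y x.
    by rewrite -sorted_rconsE; apply: good_sorted g.
  (* A value of at least 2 makes [x] adjacent also to the vertex before [y], so the sequence is
     still a path after the exchange. *)
  case: (lastP p) lx => [|p' z]; first by rewrite /lm_val.
  rewrite lm_val_rcons !sorted_rconsE; case: ifP => // xz _ /andP[-> _] _.
  by rewrite esym xz.
- apply/lm_ok_rcons; split; first (apply/lm_ok_rcons; split).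
  + apply: eq_lm_ok okp => z zp; rewrite Ez //.
      by apply: contraTneq zp => ->.
    by apply: contraTneq zp => ->.
  + by right; rewrite Ex Lx; lia.
  + rewrite Ey; case: eqP => [_|Ly]; first by left.
    right; case: oky => [/Ly//|->]; rewrite lm_val_rcons yx; lia.
- move=> z zG; rewrite mem_exchange => zp; rewrite Ez.
  + exact: good_unset g _ zG zp.
  + by apply: contraNneq zp => ->; rewrite mem_rcons mem_head.
  + by apply: contraNneq zp => ->; rewrite !(mem_rcons, inE) eqxx orbT.
Qed.

Lemma good_delete G p y x L : good G (rcons (rcons p y) x) L ->
  good (G :\: [set y; x]) p L.
Proof.
move=> g; have := good_uniq g; rewrite !rcons_uniq mem_rcons inE negb_or.
case/and3P => /andP[nxy xp] yp up; split=> //.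
- move=> z zp; rewrite !inE negb_or.
  have -> : z \in G by apply: good_sub g _ _; rewrite !(mem_rcons, inE) zp !orbT.
  by rewrite andbT; apply/andP; split; apply: contraTneq zp => ->.
- have := good_sorted g; rewrite sorted_rconsE => /andP[+ _].
  by case: (p) => //= a q; rewrite rcons_path => /andP[].
- by have := good_lm g => /lm_ok_rcons[/lm_ok_rcons[]].
- move=> z; rewrite !inE negb_or => /andP[/andP[zy zx] zG] zp.
  by apply: good_unset g _ zG _; rewrite !(mem_rcons, inE) !negb_or zx zy.
Qed.

(** What the last test of the repeat loop established has to be kept until the deletion, where
    [delete_pair_connected] needs it. *)
Definition ctrl_ok (s : state V) : Prop :=
  match ctrl s with
  | AtWhile => True
  | AtRepeat => 2 <= #|current s| /\ upath s != [::]
  | AfterRepeat => exists p y x,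
      [/\ upath s = rcons (rcons p y) x,
          fresh e (current s) (upath s) x = set0
        & fresh e (current s) (upath s) y = set0 \/ lm_val e (rcons p y) x <= 1]
  end.

Record run_inv (s : state V) : Prop := RunInv {
  inv_even : ~~ odd #|current s|;
  inv_conn : cut_connected e (current s);
  inv_good : good (current s) (upath s) (lm_nb s);
  inv_edges : matching s \subset edges e;
  inv_triv : trivIset (matching s);
  inv_cover : cover (matching s) = ~: current s;
  inv_ctrl : ctrl_ok s }.

Lemma inv_initial : symmetric e -> connected_graph e -> ~~ odd #|V| ->
  run_inv (initial V).
Proof.
move=> esym conn ev; split=> //=.
- by rewrite cardsT.
- exact: connected_cut.
- split=> //= [|x _ _]; last by rewrite ffunE.
  by case=> [|? ?] ? ?.
- exact: sub0set.
- by apply/trivIsetP => A B; rewrite inE.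
- by rewrite /cover big_set0 setCT.
Qed.

Lemma card_delete (G : {set V}) y x : y != x -> y \in G -> x \in G ->
  #|G :\: [set y; x]|.+2 = #|G|.
Proof.
move=> yx yG xG; rewrite -(cardsID [set y; x] G).
have /setIidPr -> : [set y; x] \subset G by apply/subsetP => z /set2P[]->.
by rewrite cards2 yx.
Qed.

Lemma good_last2 G p y x L : good G (rcons (rcons p y) x) L ->
  [/\ y != x, y \in G, x \in G & e y x].
Proof.
move=> g; split.
- by have := good_uniq g; rewrite rcons_uniq mem_rcons inE negb_or eq_sym => /andP[/andP[]].
- by apply: good_sub g _ _; rewrite !(mem_rcons, inE) eqxx orbT.
- by apply: good_sub g _ _; rewrite !(mem_rcons, inE) eqxx.
- by have := good_sorted g; rewrite sorted_rconsE => /andP[].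
Qed.

(** An extension requires that the path misses a vertex of [G]; hence the truncated difference in
    [measure] is positive before an extension and really drops. *)
Lemma fresh_le G (p : seq V) u v : v \in fresh e G p u -> uniq p -> {subset p <= G} ->
  size p < #|G|.
Proof.
rewrite in_fresh => /and3P[vp vG _] up pG.
have : uniq (v :: p) by rewrite /= vp.
move/card_uniqP => /= <-; apply: subset_leq_card; apply/subsetP => z.
by rewrite inE => /orP[/eqP->//|]; apply: pG.
Qed.

(* [k <= #|G|] only grows, except when two vertices are deleted. *)
Definition measure (s : state V) : nat :=
  2 * #|current s| + (#|current s| - size (upath s)) +
  match ctrl s with AtWhile => 2 | AtRepeat => 1 | AfterRepeat => 0 end.

Hypotheses (esym : symmetric e) (eirr : irreflexive e) (claw : claw_free e).

Lemma step_inv s s' : run_inv s -> step e s s' ->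
  run_inv s' /\ measure s' < measure s.
Proof.
move=> [ev conn g Me Mt Mc c] st; case: st ev conn g Me Mt Mc c => /=.
- move=> M G u v L G2 uG uv ev conn g Me Mt Mc c; split.
    split=> //=; apply: good_start => //; apply: (edge_neq eirr).
    by move: uv; rewrite inE => /andP[].
  by rewrite /measure /=; lia.
- by move=> M G p L G2 p0 ev conn g Me Mt Mc c; split=> //; rewrite /measure /=; lia.
- move=> M G p x v L vf ev conn g Me Mt Mc c; split.
    split=> //=; first exact: good_extend.
    by rewrite /ctrl_ok /= -size_eq0 size_rcons; case: c.
  have := fresh_le vf (good_uniq g) (good_sub g).
  by rewrite /measure /= !size_rcons; lia.
- move=> M G p y x v L L' fx lc L2 vf ev conn g Me Mt Mc c.
  have [g' L'x] := good_compute esym g lc; split.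
    split=> //=.
      apply: good_extend; first exact: good_exchange.
      by rewrite fresh_exchange.
    by rewrite /ctrl_ok /= -size_eq0 size_rcons; case: c.
  have := fresh_le vf (good_uniq g) (good_sub g).
  by rewrite /measure /= !size_rcons; lia.
- move=> M G p y x L L' fx lc no ev conn g Me Mt Mc c.
  have [g' L'x] := good_compute esym g lc; split; last by rewrite /measure /=; lia.
  split=> //=; exists p, y, x; split=> //=.
  move: no; rewrite L'x negb_and negbK => /orP[h|/eqP]; [right|by left].
  by move: h; rewrite lez_nat -ltnNge.
- move=> M G p y x L ev conn g Me Mt Mc c.
  have [nyx yG xG yx] := good_last2 g.
  have cardG := card_delete nyx yG xG.
  case: c => p' [y'] [x'] [/rcons_inj[/rcons_inj[<- <-] <-] fx fy].
  (* Two deleted vertices take 4 from [measure], the return to [AtWhile] adds 2, and the difference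
     between order and path length is unchanged. *)
  split; last by rewrite /measure /= !size_rcons -cardG; lia.
  have cov : cover [set [set y; x]] = [set y; x] by rewrite /cover big_set1.
  split=> //=.
  + by move: ev; rewrite -cardG /= negbK.
  + exact: delete_pair_connected conn (good_sub g) (good_uniq g) (good_sorted g) fx fy.
  + exact: good_delete.
  + rewrite subUset Me sub1set; apply/imset2P; exists y x => //.
    by rewrite inE in_setT.
  + rewrite trivIsetU ?trivIset1 // cov Mc.
    rewrite disjoint_sym disjoints_subset setCK.
    by apply/subsetP => z /set2P[]->.
  + by rewrite /cover bigcup_setU -/(cover M) -/(cover [set _]) cov Mc setCD.
Qed.

(** Connectedness excludes the stuck states: a cut around one vertex supplies the starting edge, and
    an extension when the path is a single vertex. The maximum for lm_nb exists because u_(k-1) is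
    adjacent to u_k. *)
Lemma inv_progress s : run_inv s -> returned s \/ exists s', step e s s'.
Proof.
case: s => [[] M G p L] [ev conn g Me Mt Mc]; rewrite /ctrl_ok /= in ev conn g Me Mt Mc *.
- move=> _; case: (ltnP #|G| 2) => G2; first by left.
  right; case: (boolP (p == [::])) => [/eqP pE|p0]; last first.
    by exists (State AtRepeat M G p L); apply: Resume.
  have [u uG] : exists u, u \in G by apply/set0Pn; rewrite -card_gt0; lia.
  have [|| a [v [au]]] := conn [set u].
  + by apply/set0Pn; exists u; rewrite inE.
  + by rewrite properEcard sub1set uG cards1.
  + rewrite inE (set1P au) => /andP[_ vG] uv.
    by rewrite pE; exists (State AtRepeat M G [:: u; v] L); apply: Start; rewrite ?inE ?vG.
- case=> G2 p0; right.
  case: (lastP p) g p0 => // q x g _.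
  case: (set_0Vmem (fresh e G (rcons q x) x)) => [fx|[v vf]]; last first.
    by exists (State AtRepeat M G (rcons (rcons q x) v) L); apply: Extend.
  case: (lastP q) => [|q' y] in g fx *.
    have xG : x \in G by apply: good_sub g _ _; rewrite inE.
    have [|| a [v [ax]]] := conn [set x].
    + by apply/set0Pn; exists x; rewrite inE.
    + by rewrite properEcard sub1set xG cards1.
    + rewrite inE (set1P ax) => /andP[vx vG] xv.
      by rewrite (fresh0 fx) ?inE // in xv; rewrite !inE in vx.
  have [nyx yG xG yx] := good_last2 g.
  have sub : {subset rcons q' y <= G}.
    by move=> z zp; apply: good_sub g _ _; rewrite mem_rcons inE zp orbT.
  have [L' lc] : exists L', lm_compute e G (rcons q' y) x L L'.
    rewrite /lm_compute; case: (L x == (-1)%R); last by exists L.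
    exists (upd L x (Posz (lm_val e (rcons q' y) x))), (lm_val e (rcons q' y) x).
    have lrE l := lm_rangeE e x l sub.
    split=> // [|l' /lrE/andP[]//].
    by apply/lrE; rewrite leqnn andbT lm_val_rcons esym yx.
  case: (boolP ((2 <= L' x)%R && (fresh e G (rcons (rcons q' y) x) y != set0))).
    case/andP => L2 /set0Pn[v vf].
    exists (State AtRepeat M G (rcons (rcons (rcons q' x) y) v) (lm_exchange y x L')).
    exact: ExchangeExtend.
  move=> no; exists (State AfterRepeat M G (rcons (rcons q' y) x) L').
  exact: NoExtension.
- case=> q [y] [x] [-> _ _]; right.
  by exists (State AtWhile (M :|: [set [set y; x]]) (G :\: [set y; x]) q L); apply: Match.
Qed.

(** Parity turns fewer than two remaining vertices into none. *)
Lemma inv_returned s : run_inv s -> returned s -> perfect_matching e (matching s).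
Proof.
move=> [ev _ _ Me Mt Mc _] [_ G1]; split=> //.
rewrite Mc; have -> : current s = set0; last exact: setC0.
by apply/eqP; rewrite -cards_eq0; case: #|_| ev G1 => [|[]].
Qed.

Lemma inv_always s : run_inv s -> always_returns e (perfect_matching e) s.
Proof.
have [N] := ubnP (measure s); elim: N s => // N IH s ms i.
case: (inv_progress i) => [r|ex]; first by apply: Always_returned => //; apply: inv_returned.
apply: Always_step => // s' st; have [i' lt] := step_inv i st.
by apply: IH => //; lia.
Qed.

End Invariant.

(** * The machine *)

Definition straight (a : cmd) : bool :=
  match a with Assign _ _ | Write _ _ _ => true | _ => false end.

Definition exec1 (m : store) (a : cmd) : store :=
  match a with
  | Assign r x => set_reg m r (eval m x)
  | Write A i x => set_arr m A (eval m i) (eval m x)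
  | _ => m
  end.

Definition exec (m : store) (c : seq cmd) : store := foldl exec1 m c.

Lemma iter_straight c k m : all straight c ->
  iter (size c) tick (c ++ k, m) = (k, exec m c).
Proof.
elim: c m => //= a c IH m /andP[sa sc]; rewrite -iterS iterSr.
by case: a sa => // [r x|A i x] _; rewrite /= IH.
Qed.

Lemma iter_trans a b c1 c2 c3 : iter a tick c1 = c2 -> iter b tick c2 = c3 ->
  iter (a + b) tick c1 = c3.
Proof. by move=> <- <-; rewrite addnC iterD. Qed.

Lemma iter_if b b' c1 c2 k m : holds m b = b' ->
  iter 1 tick (If b c1 c2 :: k, m) = ((if b' then c1 else c2) ++ k, m).
Proof. by move=> <-. Qed.

Lemma iter_enter b c k m : holds m b ->
  iter 1 tick (While b c :: k, m) = (c ++ While b c :: k, m).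
Proof. by move=> hb /=; rewrite hb. Qed.

Lemma iter_exit b c k m : ~~ holds m b -> iter 1 tick (While b c :: k, m) = (k, m).
Proof. by move=> /negbTE hb /=; rewrite hb. Qed.

(** A loop rule with a rank [j]. The time is charged to the drop from [j] to [j'] rather than to [j]
    itself, so that a loop stopping early leaves the rest of its budget to later runs. Each round
    costs the body and one test; the final 1 is the failing test. *)
Lemma iter_while b body k (I : nat -> store -> Prop) : all straight body ->
  (forall j m, I j m -> holds m b -> exists2 j', j' < j & I j' (exec m body)) ->
  forall j m, I j m -> exists t m' j',
    [/\ iter t tick (While b body :: k, m) = (k, m'), I j' m', ~~ holds m' b
      & t + (size body).+1 * j' <= (size body).+1 * j + 1].
Proof.
move=> sb step j; have [N] := ubnP j; elim: N j => // N IH j jN m Ijm.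
have [hb|nb] := boolP (holds m b); last first.
  by exists 1, m, j; rewrite /= (negbTE nb); split=> //; lia.
have [j' j'j I'] := step j m Ijm hb.
have [t [m' [j'' [it I'' nb le]]]] := IH j' (leq_trans j'j jN) _ I'.
exists ((size body).+1 + t), m', j''; split=> //.
  apply: iter_trans it; rewrite iterSr /= hb.
  by rewrite -(iter_straight (While b body :: k) m sb).
have : (size body).+1 * j'.+1 <= (size body).+1 * j by rewrite leq_mul2l j'j orbT.
by rewrite mulnS; lia.
Qed.

(** * Machine runs that follow an execution of PMinCF *)

Section Simulation.

Variables (n : nat) (e : rel 'I_n) (nb : 'I_n -> seq 'I_n).

(* [sim c s T]: from [c] the machine carries out, within [T] ticks, an
   execution of PMinCF that starts in [s]. *)
Inductive sim : config -> state 'I_n -> nat -> Prop :=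
| SimHalt c s T : halted c -> returned s -> represents c.2 s -> sim c s T
| SimTick k c s T : sim (iter k tick c) s T -> sim c s (k + T)
| SimStep c s s' T : represents c.2 s -> step e s s' -> sim c s' T -> sim c s T.

Lemma sim_run c s T : sim c s T ->
  exists (l : nat) (ss : nat -> state 'I_n) (t : nat -> nat),
    let conf i := iter (t i) tick c in
    [/\ ss 0 = s /\ (forall i, i < l -> step e (ss i) (ss i.+1)),
        returned (ss l),
        (forall i, i < l -> t i <= t i.+1),
        (forall i, i <= l -> represents (conf i).2 (ss i))
      & halted (conf l) /\ t l <= T].
Proof.
elim=> {c s T} [c s T h r rep|k c s T _|c s s' T rep st _].
- by exists 0, (fun=> s), (fun=> 0); split.
- move=> [l [ss [t [s0 r mono rep [h tT]]]]].
  exists l, ss, (fun i => t i + k); split=> //.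
  + by move=> i il; rewrite leq_add2r mono.
  + by move=> i il; rewrite iterD; apply: rep.
  + by rewrite iterD; split=> //; rewrite addnC leq_add2l.
- move=> [l [ss [t [[s0 sts] r mono reps [h tT]]]]].
  exists l.+1, (fun i => if i is j.+1 then ss j else s).
  exists (fun i => if i is j.+1 then t j else 0); split=> //.
  + by split=> // -[|i] il; [rewrite s0|apply: sts].
  + by case=> // i il; apply: mono.
  + by case=> // i il; apply: reps.
Qed.

End Simulation.

(* [rG] holds the number of current vertices; all vertices below [rI] are
   deleted. [rF] is the control flag of the repeat loop. *)
Definition rG := 3.
Definition rI := 4.
Definition rX := 5.
Definition rY := 6.
Definition rF := 7.
Definition rJ := 8.
Definition rL := 9.
Definition rV := 10.
(* [aPtr]: position in [aNb] up to which the list of a vertex has been searched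
   for an extension. [aVis]: nonzero once the vertex has been on the path.
   [aMark]: x + 1 on neighbors of x; since a mark identifies its x, the array
   need not be cleared between two computations of lm_nb. *)
Definition aPtr := 7.
Definition aVis := 8.
Definition aMark := 9.

Definition has_next (r : nat) : test :=
  Lt (Read aPtr (Reg r)) (Read aStart (Succ (Reg r))).

Definition candidate (r : nat) : expr := Read aNb (Read aPtr (Reg r)).

Definition advance (r : nat) : cmd :=
  While (And (has_next r) (Not (Eq (Read aVis (candidate r)) (Const 0))))
    [:: Write aPtr (Reg r) (Succ (Read aPtr (Reg r)))].

Definition push : seq cmd :=
  [:: Assign rK (Succ (Reg rK)); Write aU (Reg rK) (Reg rV);
      Write aVis (Reg rV) (Const 1)].

Definition find_current : cmd :=
  While (Not (Eq (Read aDel (Reg rI)) (Const 0))) [:: Assign rI (Succ (Reg rI))].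

(** The second end of the starting edge is found by [advance] at the first end, so this search too
    is charged to a pointer that never moves back. *)
Definition start_code : seq cmd :=
  find_current :: Assign rV (Reg rI) :: push ++
  [:: Assign rX (Reg rI); advance rX; Assign rV (candidate rX)] ++ push.

Definition mark_loop : cmd :=
  While (Lt (Reg rJ) (Read aStart (Succ (Reg rX))))
    [:: Write aMark (Read aNb (Reg rJ)) (Succ (Reg rX));
        Assign rJ (Succ (Reg rJ))].

(* [rL] counts from 1, since [aLm] stores lm_nb + 1. *)
Definition count_loop : cmd :=
  While (And (Lt (Const 0) (Reg rJ))
             (Eq (Read aMark (Read aU (Reg rJ))) (Succ (Reg rX))))
    [:: Assign rL (Succ (Reg rL)); Assign rJ (Pred (Reg rJ))].

Definition compute_code : seq cmd :=
  [:: Assign rJ (Read aStart (Reg rX)); mark_loop;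
      Assign rJ (Pred (Reg rK)); Assign rL (Const 1); count_loop;
      Write aLm (Reg rX) (Reg rL)].

Definition exchange_code : seq cmd :=
  [:: Write aLm (Reg rX) (Pred (Read aLm (Reg rX)));
      If (Lt (Const 0) (Read aLm (Reg rY)))
         [:: Write aLm (Reg rY) (Succ (Read aLm (Reg rY)))] [::];
      Write aU (Pred (Reg rK)) (Reg rX); Write aU (Reg rK) (Reg rY);
      Assign rV (candidate rY)] ++ push.

(** The pointer of u_(k-1) is advanced before lm_nb(u_k) is tested; this does not change the
    represented state. The threshold is 2 under a strict comparison because [aLm] is shifted by
    one. *)
Definition no_fresh_code : seq cmd :=
  [:: If (Eq (Read aLm (Reg rX)) (Const 0)) compute_code [::];
      Assign rY (Read aU (Pred (Reg rK))); advance rY;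
      If (And (Lt (Const 2) (Read aLm (Reg rX))) (has_next rY))
         exchange_code [:: Assign rF (Const 0)]].

Definition repeat_code : seq cmd :=
  [:: Assign rX (Read aU (Reg rK)); advance rX;
      If (has_next rX) (Assign rV (candidate rX) :: push) no_fresh_code].

Definition repeat_loop : cmd := While (Eq (Reg rF) (Const 1)) repeat_code.

Definition match_code : seq cmd :=
  [:: Assign rX (Read aU (Reg rK)); Assign rK (Pred (Reg rK));
      Assign rY (Read aU (Reg rK)); Assign rK (Pred (Reg rK));
      Write aM1 (Reg rM) (Reg rY); Write aM2 (Reg rM) (Reg rX);
      Assign rM (Succ (Reg rM));
      Write aDel (Reg rX) (Const 1); Write aDel (Reg rY) (Const 1);
      Assign rG (Pred (Pred (Reg rG)))].

Definition main_loop : cmd :=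
  While (Lt (Const 1) (Reg rG))
    ([:: If (Eq (Reg rK) (Const 0)) start_code [::]; Assign rF (Const 1);
         repeat_loop] ++ match_code).

Definition pmincf : program :=
  [:: Assign rG (Reg rN);
      While (Lt (Reg rI) (Reg rN))
        [:: Write aPtr (Reg rI) (Read aStart (Reg rI));
            Assign rI (Succ (Reg rI))];
      Assign rI (Const 0); main_loop].

(** * The program carries out PMinCF *)

Section Implementation.

Variables (n : nat) (e : rel 'I_n) (nb : 'I_n -> seq 'I_n).
Hypotheses (e_sym : symmetric e) (e_irr : irreflexive e) (claw : claw_free e).
Hypothesis nbP : neighborhood_lists e nb.

(** * Layout of the neighborhood lists and the degree sum *)

Definition start (i : nat) : nat := arr (input nb) aStart i.
Definition cell (j : nat) : nat := arr (input nb) aNb j.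

Lemma nth_enum (v : 'I_n) : nth v (enum 'I_n) v = v.
Proof. by apply: val_inj; rewrite /= nth_enum_ord. Qed.

Lemma startS (v : 'I_n) : start v.+1 = start v + size (nb v).
Proof.
rewrite /start /=; set s := map _ _.
have szs : size s = n by rewrite size_map size_enum_ord.
rewrite (take_nth 0) ?szs // -cats1 sumn_cat /= addn0.
by rewrite (nth_map v) ?size_enum_ord ?nth_enum.
Qed.

Lemma start_cell (v : 'I_n) j : j < size (nb v) ->
  cell (start v + j) = nth v (nb v) j.
Proof.
move=> jlt; rewrite /cell /start /=.
set ss := [seq [seq val w | w <- nb u] | u <- enum 'I_n].
have szs : size ss = n by rewrite size_map size_enum_ord.
have -> : [seq size (nb u) | u <- enum 'I_n] = shape ss.
  by rewrite /shape /ss -map_comp; apply: eq_map => u /=; rewrite size_map.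
have nthv : nth [::] ss v = [seq val w | w <- nb v].
  by rewrite (nth_map v) ?size_enum_ord ?nth_enum.
have {1}-> : ss = take v ss ++ nth [::] ss v :: drop v.+1 ss.
  by rewrite -drop_nth ?szs // cat_take_drop.
rewrite flatten_cat /= nth_cat size_flatten -map_take /shape -map_take.
rewrite ltnNge leq_addr /= addKn nth_cat nthv size_map jlt.
by rewrite (nth_map v).
Qed.

Lemma cell_edge (v : 'I_n) j : start v <= j < start v.+1 ->
  exists2 w : 'I_n, cell j = w & e v w.
Proof.
rewrite startS => /andP[vj jv]; exists (nth v (nb v) (j - start v)).
  by rewrite -start_cell; [congr cell|]; lia.
by case: (nbP v) => _ <-; rewrite mem_nth // ltn_subLR.
Qed.

Lemma edge_cell (v w : 'I_n) : e v w ->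
  exists2 j, start v <= j < start v.+1 & cell j = w.
Proof.
case: (nbP v) => _ <- /[dup] wn; rewrite -index_mem => wi.
exists (start v + index w (nb v)); first by rewrite startS leq_addr ltn_add2l.
by rewrite start_cell // nth_index.
Qed.

(** Double counting of ordered adjacent pairs: the pairs lying over the edge with ends [x] and [y]
    are among [(x, y)] and [(y, x)]. *)
Lemma sum_degrees : \sum_v size (nb v) <= 2 * #|edges e|.
Proof.
have -> : \sum_v size (nb v) = #|[set f : 'I_n * 'I_n | e f.1 f.2]|.
  rewrite -sum1dep_card (eq_bigl (fun f => e f.1 f.2)) //.
  rewrite -(pair_big_dep predT (fun u v => e u v) (fun _ _ => 1)) /=.
  apply: eq_bigr => u _; case: (nbP u) => un ue.
  by rewrite sum1_card -(card_uniqP un); apply: eq_card => w; rewrite ue.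
set D := [set f | _].
pose g (f : 'I_n * 'I_n) : {set {set 'I_n} } := [set [set f.1; f.2]].
rewrite mulnC -sum_nat_const -sum1_card.
rewrite (partition_big (fun f : 'I_n * 'I_n => [set f.1; f.2]) (mem (edges e))) /=.
  apply: leq_sum => A /imset2P[x y _ _ ->].
  rewrite sum1dep_card.
  apply: leq_trans (_ : #|[set (x, y); (y, x)]| <= 2); last by rewrite cards2; case: eqP.
  apply: subset_leq_card; apply/subsetP => -[a b]; rewrite !inE /= => /andP[_ /eqP E].
  have : a \in [set x; y] by rewrite -E set21.
  have : b \in [set x; y] by rewrite -E set22.
  have : x \in [set a; b] by rewrite E set21.
  have : y \in [set a; b] by rewrite E set22.
  rewrite !inE -!pair_eqE /=.
  rewrite ![_ == a]eq_sym ![_ == b]eq_sym.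
  by case: (a == x) (a == y) (b == x) (b == y) => [][][][].
by move=> [a b]; rewrite inE /= => ab; apply/imset2P; exists a b; rewrite ?inE.
Qed.

(* [m_seen] makes it sound never to move a search pointer back; [m_mark] allows
   for stale marks. *)
Record mrel (m : store) (M : {set {set 'I_n}}) (G : {set 'I_n}) (p : seq 'I_n)
    (L : {ffun 'I_n -> int}) : Prop := Mrel {
  m_start : forall i, arr m aStart i = start i;
  m_nb : forall j, arr m aNb j = cell j;
  m_N : reg m rN = n;
  m_G : reg m rG = #|G|;
  m_match : exists es : seq ('I_n * 'I_n),
        [/\ [seq (val f.1, val f.2) | f <- es] =
              mkseq (fun i => (arr m aM1 i, arr m aM2 i)) (reg m rM),
            M = [set [set f.1; f.2] | f in es]
          & #|M| = reg m rM];
  m_del : forall v : 'I_n, (arr m aDel v == 0) = (v \in G);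
  m_path : [seq val u | u <- p] = mkseq (fun i => arr m aU i.+1) (reg m rK);
  m_lm : forall v : 'I_n, Posz (arr m aLm v) = (L v + 1)%R;
  m_vis : forall v : 'I_n, (arr m aVis v == 0) = (v \in G) && (v \notin p);
  m_ptr : forall v : 'I_n, start v <= arr m aPtr v <= start v.+1;
  m_seen : forall (v : 'I_n) j, start v <= j < arr m aPtr v -> arr m aVis (cell j) != 0;
  m_I : reg m rI <= n;
  m_skip : forall v : 'I_n, v < reg m rI -> arr m aDel v != 0;
  m_mark : forall v x : 'I_n, arr m aMark v = x.+1 -> e x v }.

Lemma mrel_represents c m M G p L : mrel m M G p L ->
  represents m (State c M G p L).
Proof. by case. Qed.

Lemma mrel_reg r c m M G p L : 4 < r -> mrel m M G p L -> mrel (set_reg m r c) M G p L.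
Proof. by case: r => [|[|[|[|[|r]]]]] // _ []. Qed.

(** The entries that [advance] may still pass. Their weight 2 in [pot] is one test and one write per
    entry; the index [rI] has weight 2 for the same reason. *)
Definition ptr_pot (m : store) : nat := \sum_(v < n) (start v.+1 - arr m aPtr v).
Definition lm_pot (m : store) : nat :=
  \sum_(v < n) (if arr m aLm v == 0 then size (nb v) else 0).
(* 6 per neighbor: 3 ticks to mark it and 3 ticks to count it. *)
Definition pot (m : store) : nat :=
  2 * ptr_pot m + 6 * lm_pot m + 2 * (n - reg m rI).

(** * Effect and amortized cost of the code fragments *)

Lemma m_size m M G p L : mrel m M G p L -> reg m rK = size p.
Proof. by move/m_path/(congr1 size); rewrite size_map size_mkseq. Qed.

Lemma m_nth m M G p L x i : mrel m M G p L -> i < size p ->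
  arr m aU i.+1 = nth x p i.
Proof.
move=> H ip; have := m_path H; move/(congr1 (fun s => nth 0 s i)).
by rewrite (nth_map x) // nth_mkseq ?(m_size H).
Qed.

Lemma m_pathI m (p : seq 'I_n) : reg m rK = size p ->
  (forall x i, i < size p -> arr m aU i.+1 = nth x p i) ->
  [seq val u | u <- p] = mkseq (fun i => arr m aU i.+1) (reg m rK).
Proof.
move=> sz H; apply: (@eq_from_nth _ 0); first by rewrite size_map size_mkseq sz.
move=> i; rewrite size_map => ip.
case: p => // x0 p in sz H ip *.
by rewrite (nth_map x0) // nth_mkseq ?sz // (H x0).
Qed.

(** Entries behind the pointer are visited, hence deleted or on the path by [m_vis]. So a stop
    inside the list shows a fresh neighbor, and a stop at its end proves that there is none. *)
Lemma advance_spec r (v : 'I_n) k m M G p L : mrel m M G p L -> reg m r = v ->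
  exists t m', [/\ iter t tick (advance r :: k, m) = (k, m'), mrel m' M G p L,
    reg m' = reg m, t + pot m' <= pot m + 1
    & if holds m' (has_next r)
      then exists2 w : 'I_n, eval m' (candidate r) = w & w \in fresh e G p v
      else fresh e G p v = set0].
Proof.
move=> H rv.
pose I j m' := [/\ mrel m' M G p L, reg m' = reg m, j = ptr_pot m'
                 & lm_pot m' = lm_pot m].
have [||t [m' [j [it [H' reg' jE lmE] nh le]]]] :=
    @iter_while (And (has_next r) (Not (Eq (Read aVis (candidate r)) (Const 0))))
      [:: Write aPtr (Reg r) (Succ (Read aPtr (Reg r)))] k I isT _ (ptr_pot m) m.
- move=> _ m1 [H1 reg1 -> lm1] /andP[/= lt vis].
  rewrite reg1 rv in lt vis *.
  set m2 := set_arr _ _ _ _.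
  have ptrE (w : 'I_n) : arr m2 aPtr w = if w == v then (arr m1 aPtr v).+1 else arr m1 aPtr w.
    by rewrite /m2 /=.
  rewrite (m_start H1) in lt; rewrite (m_nb H1) in vis.
  exists (ptr_pot m2); last first.
    split=> //; case: (H1) => *; split=> //.
      by move=> w; rewrite ptrE; case: eqP => [->|//]; rewrite lt leqW // ; case/andP: (m_ptr H1 v).
    move=> w j; rewrite ptrE; case: eqP => [->|_]; last exact: (m_seen H1).
    rewrite ltnS [j <= _]leq_eqVlt => /andP[vj /orP[/eqP->//|jlt]].
    by apply: (m_seen H1 (v := v)); rewrite vj jlt.
  rewrite /ptr_pot (bigD1 v) // [ltnRHS](bigD1 v) // ptrE eqxx.
  rewrite (eq_bigr (fun w : 'I_n => start w.+1 - arr m1 aPtr w)); last first.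
    by move=> w /negbTE wv; rewrite ptrE wv.
  by rewrite ltn_add2r; lia.
- by split.
- rewrite [size _]/= in le.
  exists t, m'; split=> //; first by rewrite /pot reg' lmE -jE; lia.
  move: nh => /=; rewrite reg' rv (m_start H') (m_nb H').
  case/andP: (m_ptr H' v) => sp pe.
  case: ltnP => [lt|ge] /=.
    have [w cw vw] := cell_edge (introT andP (conj sp lt)).
    rewrite cw negbK (m_vis H') => /andP[wG wp]; exists w => //.
    by rewrite in_fresh wp wG vw.
  move=> _; apply/setP => w; rewrite in_fresh inE; apply/and3P => -[wp wG vw].
  have [i /andP[vi iv] cw] := edge_cell vw.
  have : arr m' aVis (cell i) != 0 by apply: (m_seen H' (v := v)); rewrite vi (leq_trans iv).
  by rewrite cw (m_vis H') wG wp.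
Qed.

(** The indices below [rI] are all deleted, so the search stays below [n] while [G] is nonempty. *)
Lemma find_current_spec k m M G p L : mrel m M G p L -> G != set0 ->
  exists t m' (u : 'I_n), [/\ iter t tick (find_current :: k, m) = (k, m'),
    mrel m' M G p L, reg m' rI = u, u \in G & t + pot m' <= pot m + 1].
Proof.
move=> H G0.
pose I j m' := [/\ mrel m' M G p L, j = n - reg m' rI,
   ptr_pot m' = ptr_pot m & lm_pot m' = lm_pot m].
have lt m1 : mrel m1 M G p L -> reg m1 rI < n.
  move=> H1; rewrite ltn_neqAle (m_I H1) andbT; apply/eqP => E.
  case/set0Pn: G0 => v; rewrite -(m_del H1) => /eqP v0.
  by have := m_skip H1 (v := v); rewrite E ltn_ord v0 => /(_ isT).
have [||t [m' [j [it [H' jE pE lmE] nh le]]]] :=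
    @iter_while (Not (Eq (Read aDel (Reg rI)) (Const 0)))
      [:: Assign rI (Succ (Reg rI))] k I isT _ (n - reg m rI) m.
- move=> _ m1 [H1 -> p1 lm1] /= del.
  have lt1 := lt _ H1.
  exists (n - (reg m1 rI).+1); first by lia.
  split=> //; case: (H1) => *; split=> // v.
  rewrite [reg _ _]/= ltnS leq_eqVlt => /orP[/eqP->//|]; exact: (m_skip H1).
- by split.
- rewrite [size _]/= in le.
  have lt' := lt _ H'; exists t, m', (Ordinal lt'); split=> //.
    by rewrite -(m_del H'); rewrite /= negbK in nh.
  by rewrite /pot pE lmE -jE; lia.
Qed.

Lemma push_spec m M G p L (v : 'I_n) : mrel m M G p L -> reg m rV = v ->
  v \in G -> v \notin p -> mrel (exec m push) M G (rcons p v) L.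
Proof.
move=> H rv vG vp; have sz := m_size H; have nthp := m_nth _ H; case: (H) => *; split=> //.
- apply: m_pathI; first by rewrite size_rcons -sz.
  move=> x i; rewrite size_rcons ltnS => ip.
  rewrite nth_rcons [LHS]/= sz rv eqSS.
  by case: ltngtP ip => // ip _; apply: nthp.
- move=> w; rewrite [arr _ _ _]/= rv mem_rcons inE.
  by case: (eqVneq w v) => [->|wv]; rewrite ?eqxx ?andbF // (negbTE (wv : w != v :> nat)) (m_vis H).
- move=> w j lt; have := m_seen H lt; rewrite [X in _ -> X != 0]/=.
  by case: (cell j == _).
Qed.

(** The loop marks every neighbor of [x]; conversely, [m_mark] makes any mark [x.+1], even an old
    one, a true witness of adjacency. *)
Lemma mark_spec (x : 'I_n) k m M G p L : mrel m M G p L -> reg m rX = x ->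
  reg m rJ = start x ->
  exists t m', [/\ iter t tick (mark_loop :: k, m) = (k, m'), mrel m' M G p L,
    pot m' = pot m /\ (reg m' rX = x /\ reg m' rF = reg m rF),
    t <= 3 * size (nb x) + 1
    & forall v : 'I_n, (arr m' aMark v == x.+1) = e x v].
Proof.
move=> H rx rj.
pose I j m' := [/\ mrel m' M G p L, j = start x.+1 - reg m' rJ,
  pot m' = pot m /\ (reg m' rX = x /\ reg m' rF = reg m rF),
  start x <= reg m' rJ <= start x.+1
  & forall i, start x <= i < reg m' rJ -> arr m' aMark (cell i) = x.+1].
have [||t [m' [j [it [H' jE eqs le mk] nh tle]]]] :=
    @iter_while (Lt (Reg rJ) (Read aStart (Succ (Reg rX))))
      [:: Write aMark (Read aNb (Reg rJ)) (Succ (Reg rX)); Assign rJ (Succ (Reg rJ))]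
      k I isT _ (start x.+1 - start x) m.
- move=> _ m1 [H1 -> [pe [rx1 rf1]] /andP[le1 le2] mk] /=; rewrite rx1 (m_start H1) => lt.
  exists (start x.+1 - (reg m1 rJ).+1); first by lia.
  have [w cw xw] := cell_edge (introT andP (conj le1 lt)).
  rewrite (m_nb H1) cw; split=> //.
  + case: (H1) => *; split=> // v z; rewrite [arr _ _ _]/=.
    case: (eqVneq v w) => [->|vw]; last first.
      by rewrite (negbTE (vw : v != w :> nat)); apply: (m_mark H1).
    by rewrite eqxx => -[/val_inj <-].
  + by rewrite [reg _ _]/= lt leqW.
  + move=> i; rewrite [reg _ _]/= ltnS [arr _ _ _]/= -cw.
    case: (eqVneq (cell i) (cell (reg m1 rJ))) => // ne; rewrite [i <= _]leq_eqVlt.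
    case/andP => xi /orP[/eqP E|il]; first by rewrite E eqxx in ne.
    by apply: mk; rewrite xi.
- by split; rewrite ?rj ?leqnn ?startS ?leq_addr // => i; lia.
- rewrite [size _]/= in tle.
  exists t, m'; split=> //; first by have := startS x; lia.
  move=> v; apply/eqP/idP => [/(m_mark H')//|xv].
  have [i /andP[i1 i2] <-] := edge_cell xv; apply: mk; rewrite i1.
  case: eqs nh => _ [rx' _]; rewrite /= rx' (m_start H') -leqNgt.
  exact: leq_trans.
Qed.

(** The vertices counted are distinct neighbors of [x]; this lets the counting loop be charged to
    the degree. *)
Lemma lm_val_deg (p : seq 'I_n) x : uniq p -> lm_val e p x <= size (nb x).
Proof.
move=> up; case: (nbP x) => _ nx.
apply: (@leq_trans (size (filter (e x) p))); last first.
  apply: uniq_leq_size; first exact: filter_uniq.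
  by move=> v; rewrite mem_filter nx => /andP[].
elim/last_ind: p {up} => // p y IH.
by rewrite lm_val_rcons filter_rcons; case: (e x y); rewrite ?size_rcons.
Qed.

Lemma count_spec (x : 'I_n) q k m M G L : mrel m M G (rcons q x) L ->
  reg m rX = x -> reg m rJ = size q -> reg m rL = 1 ->
  (forall v : 'I_n, (arr m aMark v == x.+1) = e x v) ->
  exists t m', [/\ iter t tick (count_loop :: k, m) = (k, m'), mrel m' M G (rcons q x) L,
    pot m' = pot m /\ (reg m' rX = x /\ reg m' rF = reg m rF),
    t <= 3 * lm_val e q x + 1
    & reg m' rL = (lm_val e q x).+1].
Proof.
move=> H rx rj rl mark.
(* The rank is the part of the run still to be counted, that is [lm_val] over the prefix not yet
   read; [rL], which starts at 1, holds the rest. *)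
pose I j m' := [/\ mrel m' M G (rcons q x) L,
  j = lm_val e (take (reg m' rJ) q) x /\ reg m' rJ <= size q,
  pot m' = pot m /\ (reg m' rX = x /\ reg m' rF = reg m rF),
  reg m' rL + j = (lm_val e q x).+1
  & forall v : 'I_n, (arr m' aMark v == x.+1) = e x v].
have [||t [m' [j [it [H' [jE jq] eqs le mk] nh tle]]]] :=
    @iter_while (And (Lt (Const 0) (Reg rJ))
             (Eq (Read aMark (Read aU (Reg rJ))) (Succ (Reg rX))))
    [:: Assign rL (Succ (Reg rL)); Assign rJ (Pred (Reg rJ))]
      k I isT _ (lm_val e q x) m.
- move=> _ m1 [H1 [-> jq] [pe [rx1 rf1]] le mk] /= /andP[j0]; rewrite rx1.
  case rJE : (reg m1 rJ) j0 => [//|i] _ in jq le *.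
  rewrite (m_nth x H1) ?size_rcons ?ltnS 1?ltnW // nth_rcons jq mk => xi.
  rewrite (take_nth x jq) lm_val_rcons xi in le *.
  exists (lm_val e (take i q) x); first by [].
  set m2 := set_reg _ _ _.
  have rJ2 : reg m2 rJ = i by [].
  have rL2 : reg m2 rL = (reg m1 rL).+1 by [].
  split=> //.
  + by apply: mrel_reg => //; apply: mrel_reg.
  + by rewrite rJ2 ltnW.
  + by rewrite rL2 -le addSnnS.
- by split; rewrite ?rj ?take_size ?rl.
- have j0 : j = 0.
    case: eqs nh => _ [rx' _]; rewrite jE /= rx'.
    case rJE : (reg m' rJ) jq => [|i] jq /=; first by rewrite take0.
    rewrite (m_nth x H') ?size_rcons ?ltnS 1?ltnW // nth_rcons jq mk => /negbTE xi.
    by rewrite (take_nth x jq) lm_val_rcons xi.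
  rewrite [size _]/= in tle.
  exists t, m'; split=> //; first by lia.
  by rewrite -le j0 addn0.
Qed.

Lemma mrel_lm (x : 'I_n) c a m M G p L : mrel m M G p L -> Posz c = (a + 1)%R ->
  mrel (set_arr m aLm x c) M G p (upd L x a).
Proof.
case=> *; split=> // v; rewrite ffunE [arr _ _ _]/=.
by case: (eqVneq v x) => [->|vx]; rewrite ?eqxx // (negbTE (vx : v != x :> nat)).
Qed.

Lemma lm_potW m m' : (forall v : 'I_n, arr m aLm v != 0 -> arr m' aLm v != 0) ->
  lm_pot m' <= lm_pot m.
Proof.
move=> H; apply: leq_sum => v _; have := H v.
by case: (arr m aLm v == 0); case: (arr m' aLm v == 0) => // /(_ isT).
Qed.

Lemma lm_pot_set m (x : 'I_n) c : arr m aLm x = 0 -> c != 0 ->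
  lm_pot (set_arr m aLm x c) + size (nb x) = lm_pot m.
Proof.
move=> x0 c0; rewrite /lm_pot (bigD1 x) //= [RHS](bigD1 x) //= x0 eqxx (negbTE c0).
rewrite add0n addnC; congr (_ + _); apply: eq_bigr => v vx.
by rewrite (negbTE (vx : v != x :> nat)).
Qed.

(** Up to a constant, marking and counting each take at most 3 ticks per neighbor of [x]. The final
    write makes [aLm] nonzero at [x], which removes its degree from [lm_pot] and so frees 6 ticks
    per neighbor. *)
Lemma compute_spec p y (x : 'I_n) k m M G L :
  mrel m M G (rcons (rcons p y) x) L -> good e G (rcons (rcons p y) x) L ->
  reg m rX = x ->
  exists t m' L', [/\
    iter t tick (If (Eq (Read aLm (Reg rX)) (Const 0)) compute_code [::] :: k, m) = (k, m'),
    mrel m' M G (rcons (rcons p y) x) L', lm_compute e G (rcons p y) x L L',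
    reg m' rX = x /\ reg m' rF = reg m rF & t + pot m' <= pot m + 8].
Proof.
move=> H g rx; have lmx := m_lm H x.
have [Lx|Lx] := eqVneq (L x) (-1)%R; last first.
  have hb : holds m (Eq (Read aLm (Reg rX)) (Const 0)) = false.
    by rewrite /= rx; lia.
  exists 1, m, L; split=> //; first exact: iter_if hb.
    by rewrite /lm_compute (negbTE Lx).
  by lia.
have a0 : arr m aLm x = 0 by lia.
have hb : holds m (Eq (Read aLm (Reg rX)) (Const 0)) by rewrite /= rx a0.
set m1 := set_reg m rJ (arr m aStart (reg m rX)).
have H1 : mrel m1 M G (rcons (rcons p y) x) L by apply: mrel_reg.
have rx1 : reg m1 rX = x by [].
have rj1 : reg m1 rJ = start x by rewrite -(m_start H) -rx.
have [t2 [m2 [it2 H2 [pot2 [rx2 rf2]] le2 mk2]]] := mark_spec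
  ([:: Assign rJ (Pred (Reg rK)); Assign rL (Const 1); count_loop;
      Write aLm (Reg rX) (Reg rL)] ++ k) H1 rx1 rj1.
set m3 := set_reg (set_reg m2 rJ (reg m2 rK).-1) rL 1.
have H3 : mrel m3 M G (rcons (rcons p y) x) L.
  by apply: mrel_reg => //; apply: mrel_reg.
have rj3 : reg m3 rJ = size (rcons p y).
  by rewrite -[LHS]/(reg m2 rK).-1 (m_size H2) size_rcons.
have [t4 [m4 [it4 H4 [pot4 [rx4 rf4]] le4 rl4]]] := 
  count_spec ([:: Write aLm (Reg rX) (Reg rL)] ++ k) H3 rx2 rj3 erefl mk2.
have [_ _ _ yx] := good_last2 g.
have lm0 : 0 < lm_val e (rcons p y) x by rewrite lm_val_rcons e_sym yx.
have lmd : lm_val e (rcons p y) x <= size (nb x).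
  apply: (lm_val_deg); have := good_uniq g.
  by rewrite rcons_uniq => /andP[].
have a4 : arr m4 aLm x = 0 by have := m_lm H4 x; rewrite Lx; lia.
have ps : lm_pot (set_arr m4 aLm x (reg m4 rL)) + size (nb x) = lm_pot m4.
  by apply: lm_pot_set; rewrite ?rl4.
exists (1 + (1 + (t2 + (2 + (t4 + 1))))), (set_arr m4 aLm x (reg m4 rL)),
  (upd L x (Posz (lm_val e (rcons p y) x))); split.
- apply: (iter_trans (c2 := (compute_code ++ k, m))); first exact: iter_if hb.
  apply: (iter_trans (c2 := (behead compute_code ++ k, m1))); first by [].
  apply: iter_trans it2 _.
  apply: (iter_trans (c2 := (drop 4 compute_code ++ k, m3))); first by [].
  apply: iter_trans it4 _.
  by rewrite /= rx4.
- by apply: mrel_lm H4 _; rewrite rl4; lia.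
- rewrite /lm_compute Lx eqxx; exists (lm_val e (rcons p y) x).
  have sub : {subset rcons p y <= G}.
    by move=> z zp; apply: (good_sub g); rewrite mem_rcons inE zp orbT.
  have lrE l := lm_rangeE e x l sub.
  split=> // [|l' /lrE/andP[]//].
  by apply/lrE; rewrite lm0 leqnn.
- by split=> //; rewrite -[LHS]/(reg m4 rF) rf4 -[LHS]/(reg m2 rF) rf2.
- have E : pot (set_arr m4 aLm x (reg m4 rL)) =
      2 * ptr_pot m4 + 6 * lm_pot (set_arr m4 aLm x (reg m4 rL)) + 2 * (n - reg m4 rI) by [].
  have E4 : pot m4 = 2 * ptr_pot m4 + 6 * lm_pot m4 + 2 * (n - reg m4 rI) by [].
  have E3 : pot m3 = pot m2 by [].
  have E1 : pot m1 = pot m by [].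
  by lia.
Qed.

Lemma swap_spec p (y x : 'I_n) m M G L : mrel m M G (rcons (rcons p y) x) L ->
  mrel (set_arr (set_arr m aU (reg m rK).-1 x) aU (reg m rK) y) M G
    (rcons (rcons p x) y) L.
Proof.
move=> H; have sz := m_size H; have nthp := m_nth _ H; case: (H) => *; split=> //.
- apply: m_pathI; first by rewrite [LHS]sz !size_rcons.
  move=> z i; rewrite !size_rcons => ip; rewrite !size_rcons in nthp sz.
  set m' := set_arr _ _ _ _.
  have -> : arr m' aU i.+1 = if i.+1 == reg m rK then val y
      else if i.+1 == (reg m rK).-1 then val x else arr m aU i.+1 by [].
  rewrite sz /= !eqSS !nth_rcons !size_rcons.
  case: (ltngtP i (size p)) => [lt|gt|->].
  + rewrite ltnS (ltnW lt) ifN ?(nthp z) //; last by lia.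
    by rewrite !nth_rcons !size_rcons ltnS (ltnW lt) lt.
  + have -> : i = (size p).+1 by lia.
    by rewrite ltnn eqxx.
  + by rewrite ltnS leqnn ifN //; lia.
- by move=> v; rewrite mem_exchange; apply: (m_vis H).
Qed.

Lemma match_spec p (y x : 'I_n) m M G L : mrel m M G (rcons (rcons p y) x) L ->
  good e G (rcons (rcons p y) x) L -> cover M = ~: G ->
  mrel (exec m match_code) (M :|: [set [set y; x]]) (G :\: [set y; x]) p L.
Proof.
move=> H g Mc; have sz := m_size H; have nthp := m_nth x H; case: (H) => *.
have [nyx yG xG yx] := good_last2 g.
rewrite !size_rcons in sz nthp.
have ux : arr m aU (reg m rK) = x.
  by rewrite sz nthp // nth_rcons size_rcons ltnn eqxx.
have uy : arr m aU (reg m rK).-1 = y.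
  by rewrite sz nthp // !nth_rcons size_rcons ltnSn ltnn eqxx.
set m' := exec m match_code.
have rK' : reg m' rK = (reg m rK).-2 by [].
have rM' : reg m' rM = (reg m rM).+1 by [].
have rG' : reg m' rG = (reg m rG).-2 by [].
have M1' i : arr m' aM1 i = if i == reg m rM then val y else arr m aM1 i.
  by rewrite -[LHS]/(if i == reg m rM then arr m aU (reg m rK).-1 else arr m aM1 i) uy.
have M2' i : arr m' aM2 i = if i == reg m rM then val x else arr m aM2 i.
  by rewrite -[LHS]/(if i == reg m rM then arr m aU (reg m rK) else arr m aM2 i) ux.
have del' (v : 'I_n) : arr m' aDel v = if v \in [set y; x] then 1 else arr m aDel v.
  rewrite !inE -[v == y]/(v == y :> nat) -[v == x]/(v == x :> nat) -ux -uy.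
  rewrite -[LHS]/(if nat_of_ord v == arr m aU (reg m rK).-1 then 1
    else if nat_of_ord v == arr m aU (reg m rK) then 1 else arr m aDel v).
  by case: (nat_of_ord v == _).
split=> //.
- by rewrite rG' (m_G H) -(card_delete nyx yG xG).
- have [es [esE ME cM]] := m_match H; exists (rcons es (y, x)); split.
  + rewrite map_rcons esE rM' mkseqS.
    rewrite -[X in _ = rcons _ X]/(arr m' aM1 (reg m rM), arr m' aM2 (reg m rM)).
    rewrite M1' M2' eqxx; congr rcons.
    apply/eq_in_map => i; rewrite mem_iota add0n => /= ilt.
    by rewrite -[RHS]/(arr m' aM1 i, arr m' aM2 i) M1' M2' ltn_eqF.
  + rewrite ME; apply/setP => A; rewrite inE; apply/orP/imsetP.
      case=> [/imsetP[f fe ->]|/set1P->].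
        by exists f => //; rewrite mem_rcons inE fe orbT.
      by exists (y, x) => //; rewrite mem_rcons inE eqxx.
    case=> f; rewrite mem_rcons inE => /orP[/eqP->|fe] ->.
      by right; rewrite inE.
    by left; apply/imsetP; exists f.
  + rewrite rM' -cM setUC cardsU1 -[RHS]add1n; congr (_ + _).
    (* If the edge were already in [M], then [y] would be covered, whereas [M] covers only deleted
       vertices. *)
    have -> // : [set y; x] \notin M.
    apply/negP => yxM; have : y \in cover M by apply/bigcupP; exists [set y; x] => //; rewrite set21.
    by rewrite Mc inE yG.
- by move=> v; rewrite del' in_setD; case: ifP => //= _; apply: (m_del H).
- apply: m_pathI; first by rewrite rK' sz.
  move=> z i ip; have aU' : arr m' aU i.+1 = arr m aU i.+1 by [].
  rewrite aU' nthp; last by lia.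
  by rewrite !nth_rcons size_rcons ltnS (ltnW ip) ip (set_nth_default z).
- move=> v; rewrite -[arr m' _ _]/(arr m aVis v) (m_vis H) !(mem_rcons, inE).
  by case: (v == y); case: (v == x); rewrite ?andbF //= andbT.
- by move=> v vI; rewrite del'; case: ifP => // _; apply: (m_skip H).
Qed.

(** * Amortized simulation of the single steps *)

Definition code (c : control) : seq cmd :=
  match c with
  | AtWhile => [:: main_loop]
  | AtRepeat => repeat_loop :: match_code ++ [:: main_loop]
  | AfterRepeat => match_code ++ [:: main_loop]
  end.

Definition linked (m : store) (s : state 'I_n) : Prop :=
  mrel m (matching s) (current s) (upath s) (lm_nb s) /\
  (ctrl s = AtRepeat -> reg m rF = 1).

(** The constant 40 is a rounded common bound; the dearest step is an exchange. *)
Definition simulated (m : store) (s : state 'I_n) : Prop :=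
  exists s' t m', [/\ step e s s',
    iter t tick (code (ctrl s), m) = (code (ctrl s'), m'), linked m' s'
    & t + pot m' <= pot m + 40].

Lemma simulate_while m M G p L (s := State AtWhile M G p L) :
  run_inv e s -> linked m s -> 2 <= #|G| -> simulated m s.
Proof.
move=> i [/= H _] G2.
have hb : holds m (Lt (Const 1) (Reg rG)) by rewrite /= (m_G H).
set K := repeat_loop :: match_code ++ [:: main_loop].
have [p0|p0] := eqVneq p [::]; last first.
  have hk : holds m (Eq (Reg rK) (Const 0)) = false.
    by rewrite /= (m_size H) size_eq0 (negbTE p0).
  exists (State AtRepeat M G p L), 3, (set_reg m rF 1); split.
  - exact: Resume.
  - have -> : 3 = 1 + (1 + 1) by [].
    apply: iter_trans (_ : _ = (If (Eq (Reg rK) (Const 0)) start_code [::] :: Assign rF (Const 1) :: K, m)) _.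
      exact: iter_enter hb.
    apply: iter_trans (_ : _ = (Assign rF (Const 1) :: K, m)) _ => //.
    exact: iter_if hk.
  - by split=> //; apply: mrel_reg.
  - by rewrite -[pot (set_reg _ _ _)]/(pot m); lia.
have hk : holds m (Eq (Reg rK) (Const 0)) by rewrite /= (m_size H) p0.
rewrite {}p0 in s i H *.
have G0 : G != set0 by rewrite -card_gt0; exact: ltnW.
set K1 := Assign rF (Const 1) :: K.
set A2 := [:: Assign rX (Reg rI); advance rX; Assign rV (candidate rX)] ++ push ++ K1.
have [t1 [m1 [u [it1 H1 rI1 uG le1]]]] :=
  find_current_spec (Assign rV (Reg rI) :: push ++ A2) H G0.
set m2 := set_reg m1 rV (reg m1 rI).
have H2 : mrel m2 M G [::] L by apply: mrel_reg.
have H3 := push_spec H2 (rI1 : reg m2 rV = u) uG isT.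
rewrite -/(exec _ _) [rcons _ _]/= in H3.
set m3 := exec m2 push in H3.
set m4 := set_reg m3 rX (reg m3 rI).
have H4 : mrel m4 M G [:: u] L by apply: mrel_reg.
have [t5 [m5 [it5 H5 reg5 le5]]] := advance_spec (Assign rV (candidate rX) :: push ++ K1) H4
  (rI1 : reg m4 rX = u).
(* The cut around [u] yields a neighbor, so [advance] cannot reach the end of the list. *)
have fr : fresh e G [:: u] u != set0.
  have [||a [v [au]]] := inv_conn i (A := [set u]).
  + by apply/set0Pn; exists u; rewrite inE.
  + by rewrite properEcard sub1set uG cards1.
  + rewrite inE (set1P au) => /andP[vu vG] uv.
    by apply/set0Pn; exists v; rewrite in_fresh uv [v \in G]vG !inE in vu *; rewrite vu.
case: ifP => [_|_ f0]; last by rewrite f0 eqxx in fr.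
case=> w cw wf; move: (wf); rewrite in_fresh => /and3P[wu wG uw].
set m6 := set_reg m5 rV (eval m5 (candidate rX)).
have H6 : mrel m6 M G [:: u] L by apply: mrel_reg.
have H7 := push_spec H6 (cw : reg m6 rV = w) wG wu.
exists (State AtRepeat M G [:: u; w] L), (1 + (1 + (t1 + (1 + (3 + (1 + (t5 + (1 + (3 + 1))))))))).
exists (set_reg (exec m6 push) rF 1); split.
- by apply: Start => //; rewrite inE wG.
- apply: iter_trans (_ : _ = (If (Eq (Reg rK) (Const 0)) start_code [::] :: K1, m)) _.
    exact: iter_enter hb.
  apply: iter_trans (_ : _ = (start_code ++ K1, m)) _.
    exact: iter_if hk.
  apply: iter_trans it1 _.
  apply: iter_trans (_ : _ = (push ++ A2, m2)) _ => //.
  apply: iter_trans (_ : _ = (A2, m3)) _ => //.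
  apply: iter_trans (_ : _ = (behead A2, m4)) _ => //.
  apply: iter_trans it5 _.
  by apply: iter_trans (_ : _ = (push ++ K1, m6)) _.
- by split=> //; apply: mrel_reg.
- have -> : pot (set_reg (exec m6 push) rF 1) = pot m5 by [].
  have E : pot m4 = pot m1 by [].
  by clear - le1 le5 E; lia.
Qed.

Lemma simulate_match m M G p L (s := State AfterRepeat M G p L) :
  run_inv e s -> linked m s -> simulated m s.
Proof.
move=> i [/= H _]; case: (inv_ctrl i) => /= q [y [x [pE _ _]]].
have g := inv_good i; rewrite /= pE in H g; subst s; rewrite pE.
exists (State AtWhile (M :|: [set [set y; x]]) (G :\: [set y; x]) q L), 10, (exec m match_code).
split; [exact: Match|exact: (@iter_straight match_code)| |].
- by split=> //; apply: match_spec => //; exact: inv_cover i.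
- by have -> : pot (exec m match_code) = pot m by []; lia.
Qed.

Lemma two_le_shift (a : nat) (b : int) : Posz a = (b + 1)%R -> (2 <= b)%R = (2 < a).
Proof. by case: b => [k|k] E; [rewrite lez_nat|rewrite [LHS]/=]; lia. Qed.

Lemma exchange_spec p (y x w : 'I_n) k m M G L :
  mrel m M G (rcons (rcons p y) x) L -> reg m rX = x -> reg m rY = y ->
  eval m (candidate rY) = w -> w \in fresh e G (rcons (rcons p y) x) y ->
  (2 <= L x)%R ->
  exists t m', [/\ iter t tick (exchange_code ++ k, m) = (k, m'),
    mrel m' M G (rcons (rcons (rcons p x) y) w) (lm_exchange y x L),
    reg m' rF = reg m rF & t + pot m' <= pot m + 9].
Proof.
move=> H rx ry cw; rewrite in_fresh => /and3P[wp wG yw] L2.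
have lmx := m_lm H x; have a2 : 2 < arr m aLm x by rewrite -(two_le_shift lmx).
set m1 := set_arr m aLm x (arr m aLm x).-1.
set L1 := upd L x (L x - 1)%R.
have H1 : mrel m1 M G (rcons (rcons p y) x) L1 by apply: mrel_lm => //; lia.
(* The code after the conditional is treated once for both of its branches. *)
have rest m2 L2' : mrel m2 M G (rcons (rcons p y) x) L2' ->
    reg m2 = reg m -> arr m2 aPtr =1 arr m aPtr -> arr m2 aNb =1 arr m aNb ->
    let m' := exec m2 (drop 2 exchange_code) in
    mrel m' M G (rcons (rcons (rcons p x) y) w) L2' /\
    (reg m' rF = reg m rF /\ pot m' = pot m2).
  move=> H2 reg2 ptr2 nb2 /=; split; last by split=> //; rewrite -[LHS]/(reg m2 rF) reg2.
  have H3 := swap_spec H2; set m3 := set_arr (set_arr _ _ _ _) _ _ _ in H3.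
  have E3 : eval m3 (candidate rY) = w.
    by rewrite -cw -[LHS]/(arr m2 aNb (arr m2 aPtr (reg m2 rY))) reg2 nb2 ptr2.
  have H4 : mrel (set_reg m3 rV (eval m3 (candidate rY))) M G (rcons (rcons p x) y) L2'.
    exact: mrel_reg.
  have := push_spec H4 E3 wG; rewrite mem_exchange => /(_ wp).
  by rewrite /m3 -{1}rx -{1}ry -reg2.
have lm1y := m_lm H1 y.
have hb : holds m1 (Lt (Const 0) (Read aLm (Reg rY))) = (L1 y != -1)%R.
  have -> : holds m1 (Lt (Const 0) (Read aLm (Reg rY))) = (0 < arr m1 aLm (reg m rY)) by [].
  rewrite ry; case: eqP lm1y => [->|ne] lm1y; first by lia.
  by rewrite lt0n; apply/eqP => a0; apply: ne; move/eqP: lm1y; rewrite a0 eq_sym GRing.addr_eq0 => /eqP.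
have it1 : iter 1 tick (exchange_code ++ k, m) = (behead exchange_code ++ k, m1).
  by rewrite /m1 -rx.
(* The decrement at [x] starts from a cell above 2, so no cell of [aLm] returns to 0 and [lm_pot]
   cannot grow. *)
have pw m2 : (forall v : 'I_n, arr m1 aLm v != 0 -> arr m2 aLm v != 0) ->
    ptr_pot m2 = ptr_pot m -> reg m2 rI = reg m rI -> pot m2 <= pot m.
  move=> le1 pe re; rewrite /pot pe re leq_add2r leq_add2l leq_mul2l /=.
  apply: lm_potW => v; have := le1 v.
  rewrite -[arr m1 aLm v]/(if v == x :> nat then (arr m aLm x).-1 else arr m aLm v).
  by move=> le1v v0; apply: le1v; case: (nat_of_ord v == x) => //; lia.
have -> : lm_exchange y x L = if holds m1 (Lt (Const 0) (Read aLm (Reg rY)))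
    then upd L1 y (L1 y + 1)%R else L1 by rewrite hb.
case: ifP => hb'.
  set m2 := set_arr m1 aLm y (arr m1 aLm y).+1.
  have H2 : mrel m2 M G (rcons (rcons p y) x) (upd L1 y (L1 y + 1)%R).
    by apply: mrel_lm => //; rewrite -lm1y -addn1 PoszD.
  have [//|//|//|H' [rf' pot']] := rest _ _ H2.
  exists (1 + (1 + (1 + 6))), (exec m2 (drop 2 exchange_code)); split=> //.
  + apply: iter_trans it1 _.
    apply: iter_trans (_ : _ = (Write aLm (Reg rY) (Succ (Read aLm (Reg rY))) :: drop 2 exchange_code ++ k, m1)) _.
      exact: iter_if hb'.
    apply: iter_trans (_ : _ = (drop 2 exchange_code ++ k, m2)) _; last exact: (@iter_straight (drop 2 exchange_code)).
    by rewrite /m2 -ry.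
  + rewrite pot'; have : pot m2 <= pot m; last by lia.
    apply: pw => // v; rewrite -[arr m2 aLm v]/(if v == y :> nat then (arr m1 aLm y).+1 else arr m1 aLm v).
    by case: (nat_of_ord v == y).
have [//|//|//|H' [rf' pot']] := rest _ _ H1.
exists (1 + (1 + 6)), (exec m1 (drop 2 exchange_code)); split=> //.
+ apply: iter_trans it1 _.
  apply: iter_trans (_ : _ = (drop 2 exchange_code ++ k, m1)) _; last exact: (@iter_straight (drop 2 exchange_code)).
  exact: iter_if hb'.
+ by rewrite pot'; have : pot m1 <= pot m; [exact: pw|lia].
Qed.

(** Without an extension at u_k, any available step mentions u_(k-1). Combined with [inv_progress],
    this shows that the path has two vertices. *)
Lemma step_repeat_size s s' q x : step e s s' -> ctrl s = AtRepeat ->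
  upath s = rcons q x -> fresh e (current s) (upath s) x = set0 -> 1 < size (upath s).
Proof.
case=> //= [M G p y v L vf _ /rcons_inj[_ yx]|*|*]; rewrite ?size_rcons //.
by rewrite -yx => f0; rewrite f0 inE in vf.
Qed.

Lemma simulate_repeat m M G p L (s := State AtRepeat M G p L) :
  run_inv e s -> linked m s -> simulated m s.
Proof.
move=> i [/= H /(_ erefl) rf]; case: (inv_ctrl i) => /= G2 p0.
have g := inv_good i; rewrite /= in g.
have [s' st] : exists s', step e s s' by case: (inv_progress e_sym i) => // -[].
case: (lastP p) p0 => // {p} q x _ in s i H g st *.
set K := match_code ++ [:: main_loop].
have ux : arr m aU (reg m rK) = x.
  by rewrite (m_size H) size_rcons (m_nth x H) ?size_rcons // nth_rcons ltnn eqxx.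
set m1 := set_reg m rX (arr m aU (reg m rK)).
have H1 : mrel m1 M G (rcons q x) L by apply: mrel_reg.
have it1 : iter 2 tick (repeat_loop :: K, m) = (behead repeat_code ++ repeat_loop :: K, m1).
  by rewrite -[2]/(1 + 1); apply: iter_trans (iter_enter _ _ _) _; rewrite //= rf.
have pot1 : pot m1 = pot m by [].
have [t2 [m2 [it2 H2 reg2 le2]]] := advance_spec
  (If (has_next rX) (Assign rV (candidate rX) :: push) no_fresh_code :: repeat_loop :: K)
  H1 (ux : reg m1 rX = x).
case: ifP => hx.
  case=> w cw wf; move: (wf); rewrite in_fresh => /and3P[wp wG xw].
  set m3 := set_reg m2 rV (eval m2 (candidate rX)).
  have H3 : mrel m3 M G (rcons q x) L by apply: mrel_reg.
  have H4 := push_spec H3 (cw : reg m3 rV = w) wG wp.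
  exists (State AtRepeat M G (rcons (rcons q x) w) L), (2 + (t2 + (1 + (1 + 3)))).
  exists (exec m3 push); split.
  - exact: Extend.
  - apply: iter_trans it1 _; apply: iter_trans it2 _.
    apply: iter_trans (iter_if _ _ _ hx) _.
    apply: iter_trans (_ : _ = (push ++ repeat_loop :: K, m3)) _ => //.
  - by split=> //= _; rewrite -[LHS]/(reg m2 rF) reg2.
  - have -> : pot (exec m3 push) = pot m2 by [].
    by clear - pot1 le2; lia.
move=> fx.
have {s' st} [p [y qE]] : exists p y, q = rcons p y.
  have := step_repeat_size st erefl erefl fx; rewrite /= size_rcons.
  by case: (lastP q) => [//|p y _]; exists p, y.
rewrite {}qE {q} in s i H g H1 H2 fx ux *.
have rx2 : reg m2 rX = x by rewrite reg2.
have [t3 [m3 [L' [it3 H3 lc [rx3 rf3] le3]]]] :=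
  compute_spec (behead no_fresh_code ++ repeat_loop :: K) H2 g rx2.
have [g' L'x] := good_compute e_sym g lc.
have uy : arr m3 aU (reg m3 rK).-1 = y.
  rewrite (m_size H3) !size_rcons (m_nth x H3) ?size_rcons //=.
  by rewrite !nth_rcons size_rcons ltnSn ltnn eqxx.
set m4 := set_reg m3 rY (arr m3 aU (reg m3 rK).-1).
have H4 : mrel m4 M G (rcons (rcons p y) x) L' by apply: mrel_reg.
have pot4 : pot m4 = pot m3 by [].
set test := And (Lt (Const 2) (Read aLm (Reg rX))) (has_next rY).
have [t5 [m5 [it5 H5 reg5 le5]]] := advance_spec
  (If test exchange_code [:: Assign rF (Const 0)] :: repeat_loop :: K)
  H4 (uy : reg m4 rY = y).
have rx5 : reg m5 rX = x by rewrite reg5.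
have ry5 : reg m5 rY = y by rewrite reg5.
have rf5 : reg m5 rF = 1 by rewrite reg5 -[LHS]/(reg m3 rF) rf3 reg2.
have it : iter (2 + (t2 + (1 + (t3 + (1 + t5))))) tick (repeat_loop :: K, m) =
    (If test exchange_code [:: Assign rF (Const 0)] :: repeat_loop :: K, m5).
  apply: iter_trans it1 _; apply: iter_trans it2 _.
  apply: iter_trans (iter_if _ _ _ hx) _; apply: iter_trans it3 _.
  by apply: iter_trans (_ : _ = (drop 2 no_fresh_code ++ repeat_loop :: K, m4)) _.
have two : (2 <= L' x)%R = holds m5 (Lt (Const 2) (Read aLm (Reg rX))).
  by rewrite (two_le_shift (m_lm H5 x)) /= rx5.
have [ht|ht] := boolP (holds m5 test).
  have [lt hy] : (2 <= L' x)%R /\ holds m5 (has_next rY) by rewrite two; case/andP: ht.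
  rewrite hy => -[w cw wf].
  have [t6 [m6 [it6 H6 rf6 le6]]] :=
    exchange_spec (repeat_loop :: K) H5 rx5 ry5 cw wf lt.
  exists (State AtRepeat M G (rcons (rcons (rcons p x) y) w) (lm_exchange y x L')).
  exists (2 + (t2 + (1 + (t3 + (1 + t5)))) + (1 + t6)), m6; split.
  - exact: ExchangeExtend.
  - by apply: iter_trans it _; apply: iter_trans (iter_if _ _ _ ht) _.
  - by split=> //= _; rewrite rf6.
  - by clear - pot1 le2 le3 pot4 le5 le6; lia.
move=> fy; exists (State AfterRepeat M G (rcons (rcons p y) x) L').
exists (2 + (t2 + (1 + (t3 + (1 + t5)))) + (1 + (1 + 1))), (set_reg m5 rF 0); split.
- apply: NoExtension lc _ => //; rewrite two.
  apply: contra ht => /andP[lt fy0]; apply/andP; split=> //.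
  by case: ifP fy => // _ fy; rewrite fy eqxx in fy0.
- apply: iter_trans it _; apply: iter_trans (iter_if _ _ _ (negbTE ht)) _.
  by apply: iter_trans (_ : _ = (repeat_loop :: K, set_reg m5 rF 0)) _.
- by split=> //; apply: mrel_reg.
- have -> : pot (set_reg m5 rF 0) = pot m5 by [].
  by clear - pot1 le2 le3 pot4 le5; lia.
Qed.

Lemma simulate m s : run_inv e s -> linked m s -> ~ returned s -> simulated m s.
Proof.
case: s => [[] M G p L] i lk nr.
- apply: simulate_while => //; rewrite leqNgt; apply/negP => lt; exact: nr.
- exact: simulate_repeat.
- exact: simulate_match.
Qed.

(** * Total running time *)

Lemma sim_le c s T T' : sim e c s T -> T <= T' -> sim e c s T'.
Proof.
move=> S; elim: S T' => {c s T} [c s T h r rep|k c s T _ IH|c s s' T rep st _ IH] T' le.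
- exact: SimHalt.
- have -> : T' = k + (T' - k) by lia.
  by apply: SimTick; apply: IH; lia.
- by apply: SimStep st _ => //; apply: IH.
Qed.

(** [measure] bounds the number of remaining steps, [pot] pays for their loops, and the last tick is
    the failing test of the main loop. *)
Lemma linked_sim m s : run_inv e s -> linked m s ->
  sim e (code (ctrl s), m) s (pot m + 40 * measure s + 1).
Proof.
have [N] := ubnP (measure s); elim: N s m => // N IH s m ms i lk.
have rep : represents m s by case: lk => H _; move: (mrel_represents (ctrl s) H); case: (s).
have [r|nr] : returned s \/ ~ returned s.
  by case: (s) => [[] M G p L]; rewrite /returned /=; case: (#|G| < 2); auto; right; case.
- rewrite addnC; apply: (@SimTick _ _ 1).
  have h : ~~ holds m (Lt (Const 1) (Reg rG)).
    by case: lk => H _; rewrite /= (m_G H) -leqNgt -ltnS; case: r.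
  by rewrite (proj1 r) (iter_exit _ _ h); apply: SimHalt.
- have [s' [t [m' [st it lk' le]]]] := simulate i lk nr.
  have [i' lt] := step_inv e_sym e_irr claw i st.
  apply: (SimStep (c := (code (ctrl s), m)) rep st).
  have S := IH s' m' (leq_trans lt ms) i' lk'.
  apply: (@sim_le _ _ (t + (pot m' + 40 * measure s' + 1))).
    by apply: SimTick; rewrite it.
  by clear - le lt; lia.
Qed.

(** At the start no entry has been passed and no lm_nb computed, so [ptr_pot] and [lm_pot] are at
    most the degree sum; their weights 2 and 6 give the 8. *)
Lemma init_spec : exists t m,
  [/\ iter t tick (pmincf, input nb) = ([:: main_loop], m),
      linked m (initial 'I_n), t <= 3 * n + 3
    & pot m <= 8 * \sum_v size (nb v) + 2 * n].
Proof.
pose m0 := set_reg (input nb) rG n.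
pose I j m := [/\ reg m rI <= n, j = n - reg m rI,
  [/\ reg m rN = n, reg m rG = n, reg m rM = 0 & reg m rK = 0],
  forall A i, A != aPtr -> arr m A i = arr (input nb) A i
  & forall v, v < reg m rI -> arr m aPtr v = start v].
have [||t [m [j [it [In _ [mN mG mM mK] marr mptr] nh le]]]] :=
    @iter_while (Lt (Reg rI) (Reg rN))
      [:: Write aPtr (Reg rI) (Read aStart (Reg rI)); Assign rI (Succ (Reg rI))]
      [:: Assign rI (Const 0); main_loop] I isT _ n m0.
- move=> _ m [In -> [mN mG mM mK] marr mptr] /= lt; rewrite mN in lt.
  exists (n - (reg m rI).+1); first by lia.
  split=> //.
    move=> A i nA; rewrite -(marr A i nA) -[LHS]/(if (A == aPtr) && (i == reg m rI)
      then arr m aStart (reg m rI) else arr m A i).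
    by rewrite (negbTE nA).
  move=> v; rewrite -[reg _ rI]/(reg m rI).+1 ltnS leq_eqVlt.
  set m' := set_reg _ _ _.
  have -> : arr m' aPtr v = if v == reg m rI then arr m aStart (reg m rI) else arr m aPtr v by [].
  by case: eqP => [->|_] /=; [rewrite marr|apply: mptr].
- by split; rewrite // [reg _ _]/= subn0.
have nI : reg m rI = n.
  by apply/eqP; rewrite eqn_leq In; rewrite /= mN -leqNgt in nh.
have mptr' (v : 'I_n) : arr m aPtr v = start v by rewrite mptr // nI.
rewrite [size _]/= in le.
exists (1 + (t + 1)), (set_reg m rI 0); split; last first.
- have ptr0 : ptr_pot m <= \sum_v size (nb v).
    by apply: leq_sum => v _; rewrite mptr' startS addKn.
  have lm0 : lm_pot m <= \sum_v size (nb v).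
    by apply: leq_sum => v _; case: ifP.
  rewrite -[pot _]/(2 * ptr_pot m + 6 * lm_pot m + 2 * (n - 0)).
  by clear - ptr0 lm0; lia.
- by clear - le; lia.
- split=> //; split=> //.
  + by move=> i; rewrite -[LHS]/(arr m aStart i) marr.
  + by move=> i; rewrite -[LHS]/(arr m aNb i) marr.
  + by rewrite -[LHS]/(reg m rG) mG cardsT card_ord.
  + exists [::]; rewrite -[reg _ rM]/(reg m rM) mM; split=> //; last by rewrite cards0.
    by apply/setP => A; rewrite inE; apply/esym/imsetP => -[].
  + by move=> v; rewrite -[arr _ _ _]/(arr m aDel v) marr // inE.
  + by rewrite -[reg _ rK]/(reg m rK) mK.
  + by move=> v; rewrite -[arr _ _ _]/(arr m aLm v) marr // ffunE.
  + by move=> v; rewrite -[arr _ _ _]/(arr m aVis v) marr // inE.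
  + move=> v; rewrite -[arr _ _ _]/(arr m aPtr v) mptr' leqnn startS; exact: leq_addr.
  + by move=> v i; rewrite -[arr _ aPtr _]/(arr m aPtr v) mptr'; lia.
  + by move=> v x; rewrite -[arr _ _ _]/(arr m aMark v) marr.
- by apply: iter_trans (_ : _ = (behead pmincf, m0)) _ => //; apply: iter_trans it _.
Qed.

(** At even order no vertex is alone, so connectedness gives each one a neighbor. This absorbs the
    terms linear in [n]. *)
Lemma card_le_degrees : connected_graph e -> ~~ odd n -> n <= \sum_v size (nb v).
Proof.
move=> conn ev; rewrite -{1}[n]card_ord -sum1_card; apply: leq_sum => v _.
have [||a [w [av _ vw]]] := connected_cut e_sym conn (A := [set v]).
- by apply/set0Pn; exists v; rewrite inE.
- rewrite properEcard subsetT cards1 cardsT card_ord.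
  by case: n v ev => [[]//|[|k]].
- rewrite (set1P av) in vw; case: (nbP v) => _ nv.
  by rewrite -nv in vw; case: (nb v) vw.
Qed.

Lemma pmincf_implements : connected_graph e -> ~~ odd n ->
  implements_within e nb pmincf (434 * #|edges e|).
Proof.
move=> conn ev.
have [t [m [it lk tle ple]]] := init_spec.
have i : run_inv e (initial 'I_n) by apply: inv_initial => //; rewrite card_ord.
have S := linked_sim i lk.
have n0 : 0 < n by case: conn => +; rewrite card_ord.
have nS := card_le_degrees conn ev.
have SE := sum_degrees.
have mE : measure (initial 'I_n) = 3 * n + 2.
  by rewrite /measure /= cardsT card_ord; lia.
have : sim e (pmincf, input nb) (initial 'I_n) (434 * #|edges e|).
  apply: (@sim_le _ _ (t + (pot m + 40 * measure (initial 'I_n) + 1))).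
    by apply: SimTick; rewrite it.
  (* With S the degree sum and m the number of edges, the total is at most (3n + 3) + (8S + 2n) +
     40(3n + 2) + 1 = 125n + 84 + 8S. From 1 <= n <= S <= 2m this is at most 217S, hence at most
     434m. *)
  by rewrite mE; clear - tle ple n0 nS SE; lia.
exact: sim_run.
Qed.

End Implementation.

Theorem theorem4 :
  (forall (V : finType) (e : rel V),
     symmetric e -> irreflexive e ->
     connected_graph e -> claw_free e -> ~~ odd #|V| ->
     always_returns e (perfect_matching e) (initial V))
  /\
  (exists (P : program) (C : nat),
     forall (n : nat) (e : rel 'I_n) (nb : 'I_n -> seq 'I_n),
       symmetric e -> irreflexive e ->
       connected_graph e -> claw_free e -> ~~ odd n ->
       neighborhood_lists e nb ->
       implements_within e nb P (C * #|edges e|)).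
Proof.
split=> [V e e_sym e_irr conn claw ev|]; first exact/inv_always/inv_initial.
by exists pmincf, 434 => n e nb *; apply: pmincf_implements.
Qed.
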